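(* Let $T$ and $P$ be as in the context, and let $\lambda\in\mathrm{res}^*(P)$ and $n\ge1$. Every $\lambda$-polyharmonic function $f:T\to\mathbb{C}$ of order $n$ has an integral representation $$f(x)=\sum_{r=0}^{n-1}\int_{\partial T}K^{(r)}(x,\xi\mid\lambda)\,d\nu_r(\xi),\qquad x\in T,$$ where the complex distributions $\nu_0,\dots,\nu_{n-1}$ are uniquely determined by $f$. Conversely, every function having such a representation is $\lambda$-polyharmonic of order $n$.
   Context: $T$ is a countable tree without leaves; degrees may be countably infinite. $P$ is stochastic with $p(x,y)>0$ iff $x\sim y$, and $Pf(x)=\sum_y p(x,y)f(y)$ (absolutely convergent). A function $f$ is $\lambda$-polyharmonic of order $n$ if $(\lambda I-P)^nf=0$, where all successive applications of $P$ are defined by absolutely convergent sums. Fix a root $o$, and let $\mathsf m(x)=\prod_{i=1}^k p(x_{i-1},x_i)/p(x_i,x_{i-1})$ along $\pi(o,x)=[x_0,\dots,x_k]$. $P$ is a bounded self-adjoint operator on $\ell^2(T,\mathsf m)$, and $\mathrm{res}(P)=\mathbb{C}\setminus\mathrm{spec}(P)$. For $\lambda\in\mathrm{res}(P)$, $G(x,y\mid\lambda)=((\lambda I-P)^{-1}\mathbf 1_y)(x)$. $\mathrm{res}^*(P)=\{\lambda\in\mathrm{res}(P):G(x,x\mid\lambda)\ne0\ \forall x\}$. $\partial T$ is the set of ends. $x\wedge w$ is the last common vertex of $\pi(o,x)$ and $\pi(o,w)$. $K(x,\xi\mid\lambda)=G(x,x\wedge\xi\mid\lambda)/G(o,x\wedge\xi\mid\lambda)$,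 and $K^{(r)}$ is its $r$-th derivative in $\lambda$. $x^-$ is the neighbour of $x\neq o$ closer to $o$. $\partial T_x$ is the set of ends whose ray from $o$ passes through $x$. A complex distribution is $\nu:\{\partial T_x\}\to\mathbb{C}$ with $\nu(\partial T_x)=\sum_{y^-=x}\nu(\partial T_y)$, absolutely convergent. Integral of a locally constant $\varphi$ (constant value $\varphi_x$ on $\partial T_x\setminus\bigcup_{y\in\tau,y^-=x}\partial T_y$ for each $x$ in a finite subtree $\tau\ni o$): $\int\varphi\,d\nu=\sum_{x\in\tau}\varphi_x(\nu(\partial T_x)-\sum_{y\in\tau,y^-=x}\nu(\partial T_y))$. For fixed $x$, $\xi\mapsto K^{(r)}(x,\xi\mid\lambda)$ is locally constant, with $\tau=\pi(o,x)$. *)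

(* Defs.v *)
From Stdlib Require Import Reals List ClassicalEpsilon.
From Coquelicot Require Import Coquelicot.
Set Implicit Arguments.
Unset Strict Implicit.

Local Open Scope C_scope.

Section Defs.
Variable T : Type.

Definition lsumC (g : T -> C) (L : list T) : C :=
  fold_right (fun a acc => g a + acc) 0 L.

Definition lsumR (g : T -> R) (L : list T) : R :=
  fold_right (fun a acc => (g a + acc)%R) 0%R L.

Definition abs_summable (g : T -> C) : Prop :=
  exists M : R, forall L : list T, NoDup L -> (lsumR (fun a => Cmod (g a)) L <= M)%R.

Definition has_usum (g : T -> C) (s : C) : Prop :=
  forall eps : R, (0 < eps)%R -> exists L0 : list T, NoDup L0 /\
    forall L : list T, NoDup L -> incl L0 L -> (Cmod (lsumC g L - s) < eps)%R.

(** the value of the sum (meaningful when [abs_summable g]) *)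
Definition usum (g : T -> C) : C := epsilon (inhabits (RtoC 0)) (has_usum g).

Definition decide (P : Prop) : bool :=
  if excluded_middle_informative P then true else false.

Definition indicator (y : T) : T -> C := fun z => if decide (z = y) then 1 else 0.

Variable adj : T -> T -> Prop.

Fixpoint chain (l : list T) : Prop :=
  match l with
  | a :: ((b :: _) as l') => adj a b /\ chain l'
  | _ => True
  end.

Fixpoint no_backtrack (l : list T) : Prop :=
  match l with
  | a :: ((_ :: c :: _) as l') => a <> c /\ no_backtrack l'
  | _ => True
  end.

Definition reduced_path (x y : T) (l : list T) : Prop :=
  hd_error l = Some x /\ last l x = y /\ chain l /\ no_backtrack l.

(** tree: simple graph in which any two vertices are joined by exactly one
    reduced path (= connected and without cycles) *)
Definition is_tree : Prop :=
  (forall x y, adj x y -> adj y x) /\ (forall x, ~ adj x x) /\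
  (forall x y, exists! l, reduced_path x y l).

Definition no_leaves : Prop := forall x, ~ (exists! y, adj x y).

Definition countable : Prop := exists e : T -> nat, forall x y, e x = e y -> x = y.

Variable o : T.

Definition geo (x : T) : list T := epsilon (inhabits nil) (reduced_path o x).

(** x^- : predecessor of x on pi(o,x) (meaningful for x <> o) *)
Definition pred_v (x : T) : T := nth (length (geo x) - 2)%nat (geo x) o.

(** ends are represented by their rays from o *)
Definition ray (xi : nat -> T) : Prop :=
  xi 0%nat = o /\ forall k, adj (xi k) (xi (S k)) /\ xi k <> xi (S (S k)).

Definition through (xi : nat -> T) (x : T) : Prop := exists k, xi k = x.

Fixpoint meet_aux (l : list T) (xi : nat -> T) (i : nat) (cur : T) : T :=
  match l with
  | nil => cur
  | a :: l' => if decide (a = xi i) then meet_aux l' xi (S i) a else cur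
  end.

Definition meet (x : T) (xi : nat -> T) : T := meet_aux (geo x) xi 0%nat o.

Variable p : T -> T -> R.

Definition stochastic : Prop :=
  (forall x y, (0 <= p x y)%R) /\ (forall x y, (0 < p x y)%R <-> adj x y) /\
  (forall x, abs_summable (fun y => RtoC (p x y)) /\ usum (fun y => RtoC (p x y)) = 1).

Definition Pop (f : T -> C) : T -> C := fun x => usum (fun y => RtoC (p x y) * f y).

Fixpoint mprod (l : list T) : R :=
  match l with
  | a :: ((b :: _) as l') => (p a b / p b a * mprod l')%R
  | _ => 1%R
  end.

(** reversing measure m *)
Definition mes (x : T) : R := mprod (geo x).

Definition l2 (g : T -> C) : Prop :=
  abs_summable (fun x => RtoC (Cmod (g x) ^ 2 * mes x)%R).

Definition in_res (lam : C) : Prop :=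
  forall h, l2 h -> exists! g, l2 g /\ forall x, lam * g x - Pop g x = h x.

Definition Green (lam : C) (x y : T) : C :=
  epsilon (inhabits (fun _ : T => RtoC 0))
    (fun g => l2 g /\ forall z, lam * g z - Pop g z = indicator y z) x.

Definition in_res_star (lam : C) : Prop :=
  in_res lam /\ forall x, Green lam x x <> 0.

Definition CDerive (f : C -> C) (z : C) : C :=
  epsilon (inhabits (RtoC 0)) (fun l => is_derive f z l).

Fixpoint CDerive_n (r : nat) (f : C -> C) : C -> C :=
  match r with
  | 0 => f
  | S r' => CDerive (CDerive_n r' f)
  end.

Definition Kern (x : T) (xi : nat -> T) (lam : C) : C :=
  Green lam x (meet x xi) / Green lam o (meet x xi).

Definition Kern_r (r : nat) (x : T) (xi : nat -> T) (lam : C) : C :=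
  CDerive_n r (fun mu => Kern x xi mu) lam.

Definition Lap (lam : C) (f : T -> C) : T -> C := fun x => lam * f x - Pop f x.

Fixpoint Lapn (lam : C) (k : nat) (f : T -> C) : T -> C :=
  match k with
  | 0 => f
  | S k' => Lap lam (Lapn lam k' f)
  end.

Definition polyharmonic (lam : C) (n : nat) (f : T -> C) : Prop :=
  (forall k, (k < n)%nat -> forall x, abs_summable (fun y => RtoC (p x y) * Lapn lam k f y))
  /\ (forall x, Lapn lam n f x = 0).

(** ** Complex distributions on the boundary, nu x = nu(partial T_x) *)
Definition is_child (y x : T) : Prop := y <> o /\ pred_v y = x.

Definition distribution (nu : T -> C) : Prop :=
  forall x, abs_summable (fun y => if decide (is_child y x) then nu y else 0)
            /\ nu x = usum (fun y => if decide (is_child y x) then nu y else 0).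

Definition pick_end (tau : list T) (x : T) : nat -> T :=
  epsilon (inhabits (fun _ : nat => o))
    (fun xi => ray xi /\ through xi x /\
       forall y, In y tau -> is_child y x -> ~ through xi y).

(** integral of a function phi locally constant w.r.t. the finite subtree tau *)
Definition integral_lc (tau : list T) (phi : (nat -> T) -> C) (nu : T -> C) : C :=
  lsumC (fun x => phi (pick_end tau x) *
           (nu x - lsumC (fun y => if decide (is_child y x) then nu y else 0) tau)) tau.

Definition represent (lam : C) (n : nat) (nu : nat -> T -> C) (x : T) : C :=
  fold_right (fun r acc => integral_lc (geo x) (fun xi => Kern_r r x xi lam) (nu r) + acc)
    0 (seq 0%nat n).

End Defs.

(* Main.v *)
(** Near a point [lam] of [res*] the kernels [K(x, v | mu) = G(x, v | mu) / G(o, v | mu)],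
    [v] a vertex, are differentiable in [mu] as l^2-valued functions, and differentiating
    [(mu - P) K(., v | mu) = 1_v / G(o, v | mu)] shows that [lam - P] maps the [r]-th derivative
    [K^(r)(., v)] to [- r K^(r-1)(., v)] up to a multiple of [1_v]. Summation by parts along
    [pi(o, x)] writes the integral of [K^(r)] against [nu] as a sum of terms
    [(K^(r)(x, x_i) - K^(r)(x, x_{i-1})) nu(x_i)]; since
    [p(x, y) (K(y, y) - K(y, x)) = 1 / G(o, x)] for every child [y] of [x], additivity of [nu] at
    [x] is exactly what cancels the multiples of [1_v], so that [lam - P] sends the integral of
    [K^(r)] to [- r] times that of [K^(r-1)]. For [n = 1] the same identity determines [nu]
    recursively from a given harmonic function; the general case follows by induction on [n],
    applying [lam - P] once. *)

Require Import Defs.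
From Stdlib Require Import Reals List Lia Lra Permutation FunctionalExtensionality ClassicalEpsilon.
From Coquelicot Require Import Coquelicot.

Local Open Scope R_scope.

(** Membership in the resolvent set says only that [lam - P] is bijective on l^2: neither a bound
    for the inverse nor any regularity in [lam] is given. The bound comes from a Baire category
    argument followed by successive halving of residuals; the same halving carries it to nearby
    [mu]. The kernels are then not differentiated as quotients. Their normalisation at [o] (value 1
    for the kernel, 0 for its derivatives) turns all the differentiated equations into one linear
    problem with an additional scalar unknown, the coefficient of [1_v]. That problem is solvable
    with a bound uniform in [mu], so a single estimate, repeated by induction on the order, gives
    derivatives of all orders on one disc. The tree structure enters through one device: a
    combination of Green functions vanishing at a vertex is cut off outside a branch there, and
    uniqueness in l^2 yields every product formula for [G]. Nonvanishing of [G(x,x)] is assumed at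
    [lam] only, so each identity between kernels is carried to a small disc before it is
    differentiated. *)

Lemma decide_true (P : Prop) : P -> decide P = true.
Proof. intros H; unfold decide; destruct (excluded_middle_informative P); tauto. Qed.

Lemma decide_false (P : Prop) : ~ P -> decide P = false.
Proof. intros H; unfold decide; destruct (excluded_middle_informative P); tauto. Qed.

Lemma Cmult_eq_0 (a b : C) : (a * b = 0 -> a = 0 \/ b = 0)%C.
Proof.
  intros H. apply (f_equal Cmod) in H. rewrite Cmod_mult, Cmod_0 in H.
  apply Rmult_integral in H. destruct H as [H|H]; apply Cmod_eq_0 in H; tauto.
Qed.

Ltac case_decide :=
  match goal with
  | |- context [decide ?P] =>
      let H := fresh "Hd" in
      destruct (excluded_middle_informative P) as [H | H];
      [rewrite (decide_true P H) | rewrite (decide_false P H)]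
  end.

Lemma usum_ext (T : Type) (f g : T -> C) : (forall x, f x = g x) -> usum f = usum g.
Proof. intros H; f_equal; apply functional_extensionality; exact H. Qed.

(** * Finite sums over lists *)

Section FiniteSums.
Context {T : Type}.
Implicit Types (L : list T).

Lemma eq_dec_classical (x y : T) : {x = y} + {x <> y}.
Proof. apply excluded_middle_informative. Qed.

Lemma incl_Permutation L0 L :
  NoDup L0 -> incl L0 L -> exists L', Permutation L (L0 ++ L').
Proof.
  revert L; induction L0 as [|a L0 IH]; intros L Hn Hi.
  - exists L; reflexivity.
  - inversion Hn as [|? ? Ha Hn']; subst.
    destruct (in_split a L) as [l1 [l2 ->]]; [apply Hi; left; reflexivity|].
    destruct (IH (l1 ++ l2)) as [L' HL']; [assumption| |].
    + intros b Hb.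
      assert (Hb' : In b (l1 ++ a :: l2)) by (apply Hi; right; exact Hb).
      apply in_app_or in Hb'; apply in_or_app.
      destruct Hb' as [|[<-|]]; [left; assumption| contradiction | right; assumption].
    + exists L'. rewrite <- Permutation_middle. simpl. constructor. exact HL'.
Qed.

Lemma NoDup_join L0 L1 : exists L, NoDup L /\ incl L0 L /\ incl L1 L.
Proof.
  exists (nodup eq_dec_classical (L0 ++ L1)); split; [apply NoDup_nodup|].
  split; intros a Ha; apply nodup_In, in_or_app; tauto.
Qed.

Lemma lsumR_perm (g : T -> R) L L' : Permutation L L' -> lsumR g L = lsumR g L'.
Proof. induction 1; simpl; lra. Qed.

Lemma lsumR_app (g : T -> R) L L' : lsumR g (L ++ L') = lsumR g L + lsumR g L'.
Proof. induction L; simpl; lra. Qed.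

Lemma lsumR_le (g h : T -> R) L :
  (forall x, In x L -> g x <= h x) -> lsumR g L <= lsumR h L.
Proof.
  induction L as [|a L IH]; simpl; intros H; [lra|].
  apply Rplus_le_compat; [apply H | apply IH]; auto.
Qed.

Lemma lsumR_ext (g h : T -> R) L :
  (forall x, In x L -> g x = h x) -> lsumR g L = lsumR h L.
Proof.
  intros H; apply Rle_antisym; apply lsumR_le; intros x Hx; rewrite (H x Hx); lra.
Qed.

Lemma lsumR_0 L : lsumR (fun _ : T => 0) L = 0.
Proof. induction L; simpl; lra. Qed.

Lemma lsumR_ge_0 (g : T -> R) L : (forall x, 0 <= g x) -> 0 <= lsumR g L.
Proof. intros H; rewrite <- (lsumR_0 L); apply lsumR_le; intros; apply H. Qed.

Lemma lsumR_plus (g h : T -> R) L :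
  lsumR (fun x => g x + h x) L = lsumR g L + lsumR h L.
Proof. induction L; simpl; lra. Qed.

Lemma lsumR_scal (c : R) (g : T -> R) L :
  lsumR (fun x => c * g x) L = c * lsumR g L.
Proof. induction L; simpl; lra. Qed.

Lemma lsumR_swap {U : Type} (g : T -> U -> R) L (L' : list U) :
  lsumR (fun x => lsumR (g x) L') L = lsumR (fun y => lsumR (fun x => g x y) L) L'.
Proof.
  induction L as [|a L IH]; simpl; [now induction L'; simpl; lra|].
  rewrite IH; clear IH.
  induction L'; simpl; lra.
Qed.

Lemma lsumR_incl (g : T -> R) L0 L :
  (forall x, 0 <= g x) -> NoDup L0 -> incl L0 L -> lsumR g L0 <= lsumR g L.
Proof.
  intros Hg Hn Hi; destruct (incl_Permutation L0 L Hn Hi) as [L' HL'].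
  rewrite (lsumR_perm _ _ _ HL'), lsumR_app.
  generalize (lsumR_ge_0 g L' Hg); lra.
Qed.

Lemma lsumC_app (g : T -> C) L L' : lsumC g (L ++ L') = (lsumC g L + lsumC g L')%C.
Proof. induction L; simpl; [ring|]. rewrite IHL; ring. Qed.

Lemma lsumC_perm (g : T -> C) L L' : Permutation L L' -> lsumC g L = lsumC g L'.
Proof. induction 1; simpl; [reflexivity|congruence|ring|congruence]. Qed.

Lemma lsumC_ext (g h : T -> C) L :
  (forall x, In x L -> g x = h x) -> lsumC g L = lsumC h L.
Proof.
  induction L as [|a L IH]; simpl; intros H; [reflexivity|].
  rewrite H, IH; auto.
Qed.

Lemma lsumC_0 L : lsumC (fun _ : T => RtoC 0) L = 0%C.
Proof. induction L; simpl; [reflexivity|rewrite IHL; ring]. Qed.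

Lemma lsumC_plus (g h : T -> C) L :
  lsumC (fun x => g x + h x)%C L = (lsumC g L + lsumC h L)%C.
Proof. induction L; simpl; [ring|rewrite IHL; ring]. Qed.

Lemma lsumC_scal (c : C) (g : T -> C) L :
  lsumC (fun x => c * g x)%C L = (c * lsumC g L)%C.
Proof. induction L; simpl; [ring|rewrite IHL; ring]. Qed.

Lemma lsumC_single (g : T -> C) (a : T) L :
  NoDup L -> In a L -> (forall x, x <> a -> g x = 0) -> lsumC g L = g a.
Proof.
  intros Hn Ha Hg.
  destruct (incl_Permutation (a :: nil) L) as [L' HL'].
  - repeat constructor; simpl; tauto.
  - intros b [<-|[]]; exact Ha.
  - rewrite (lsumC_perm _ _ _ HL'); simpl.
    assert (Hn' : NoDup (a :: L')) by (apply (Permutation_NoDup HL' Hn)).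
    inversion Hn' as [|? ? Ha' _]; subst.
    rewrite (lsumC_ext _ (fun _ => RtoC 0)), lsumC_0; [ring|].
    intros x Hx; apply Hg; intros ->; contradiction.
Qed.

Lemma Cmod_lsumC (g : T -> C) L : Cmod (lsumC g L) <= lsumR (fun x => Cmod (g x)) L.
Proof.
  induction L; simpl; [rewrite Cmod_0; lra|].
  eapply Rle_trans; [apply Cmod_triangle|lra].
Qed.

End FiniteSums.

(** * Unconditional sums over an arbitrary index type *)

Section InfiniteSums.
Context {T : Type}.
Implicit Types (g h : T -> C) (L : list T).

Lemma has_usum_unique g s t : has_usum g s -> has_usum g t -> s = t.
Proof.
  intros Hs Ht.
  destruct (Req_dec (Cmod (s - t)) 0) as [H0|H0].
  - apply Cmod_eq_0 in H0. replace s with (t + (s - t))%C by ring. rewrite H0; ring.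
  - exfalso. assert (Hp : 0 < Cmod (s - t) / 2) by (generalize (Cmod_ge_0 (s - t)); lra).
    destruct (Hs _ Hp) as [L0 [_ H1]], (Ht _ Hp) as [L1 [_ H2]].
    destruct (NoDup_join L0 L1) as [L [Hn [Hi0 Hi1]]].
    specialize (H1 L Hn Hi0); specialize (H2 L Hn Hi1).
    assert (Cmod (s - t) <= Cmod (lsumC g L - s) + Cmod (lsumC g L - t)); [|lra].
    replace (s - t)%C with (- (lsumC g L - s) + (lsumC g L - t))%C by ring.
    eapply Rle_trans; [apply Cmod_triangle|]. rewrite Cmod_opp; lra.
Qed.

Lemma usum_eq g s : has_usum g s -> usum g = s.
Proof.
  intros H; apply (has_usum_unique g); [|exact H].
  unfold usum; apply epsilon_spec; exists s; exact H.
Qed.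

Lemma has_usum_ext g h s : (forall x, g x = h x) -> has_usum g s -> has_usum h s.
Proof. intros H; replace h with g; [tauto|apply functional_extensionality; exact H]. Qed.

Lemma has_usum_plus g h s t :
  has_usum g s -> has_usum h t -> has_usum (fun x => g x + h x)%C (s + t)%C.
Proof.
  intros Hg Hh e He.
  destruct (Hg (e / 2)) as [L0 [_ H1]]; [lra|]. destruct (Hh (e / 2)) as [L1 [_ H2]]; [lra|].
  destruct (NoDup_join L0 L1) as [L [Hn [Hi0 Hi1]]].
  exists L; split; [exact Hn|]; intros L' Hn' Hi'.
  specialize (H1 L' Hn' (incl_tran Hi0 Hi')); specialize (H2 L' Hn' (incl_tran Hi1 Hi')).
  rewrite lsumC_plus.
  replace (lsumC g L' + lsumC h L' - (s + t))%C
    with ((lsumC g L' - s) + (lsumC h L' - t))%C by ring.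
  eapply Rle_lt_trans; [apply Cmod_triangle|lra].
Qed.

Lemma has_usum_scal (c : C) g s : has_usum g s -> has_usum (fun x => c * g x)%C (c * s)%C.
Proof.
  intros Hg e He.
  assert (Hc : 0 < Cmod c + 1) by (generalize (Cmod_ge_0 c); lra).
  destruct (Hg (e / (Cmod c + 1))) as [L0 [Hn H1]]; [apply Rdiv_lt_0_compat; lra|].
  exists L0; split; [exact Hn|]; intros L Hn' Hi; specialize (H1 L Hn' Hi).
  rewrite lsumC_scal. replace (c * lsumC g L - c * s)%C with (c * (lsumC g L - s))%C by ring.
  rewrite Cmod_mult.
  apply Rle_lt_trans with ((Cmod c + 1) * Cmod (lsumC g L - s)).
  - generalize (Cmod_ge_0 (lsumC g L - s)); nra.
  - replace e with ((Cmod c + 1) * (e / (Cmod c + 1))) by (field; lra).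
    apply Rmult_lt_compat_l; assumption.
Qed.

Lemma has_usum_single (a : T) g : (forall x, x <> a -> g x = 0) -> has_usum g (g a).
Proof.
  intros H e He. exists (a :: nil); split; [repeat constructor; simpl; tauto|].
  intros L Hn Hi. rewrite (lsumC_single g a L Hn); [|apply Hi; left; reflexivity|exact H].
  replace (g a - g a)%C with (RtoC 0) by ring. rewrite Cmod_0; exact He.
Qed.

Lemma abs_summable_dom g h :
  (forall x, Cmod (g x) <= Cmod (h x)) -> abs_summable h -> abs_summable g.
Proof.
  intros H [M HM]; exists M; intros L Hn.
  eapply Rle_trans; [|apply (HM L Hn)]. apply lsumR_le; intros; apply H.
Qed.

Lemma abs_summable_ext g h : (forall x, g x = h x) -> abs_summable g -> abs_summable h.
Proof. intros H; apply abs_summable_dom; intros x; rewrite H; lra. Qed.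

Lemma abs_summable_plus g h :
  abs_summable g -> abs_summable h -> abs_summable (fun x => g x + h x)%C.
Proof.
  intros [M HM] [N HN]; exists (M + N); intros L Hn.
  specialize (HM L Hn); specialize (HN L Hn).
  eapply Rle_trans; [apply lsumR_le; intros; apply Cmod_triangle|].
  rewrite lsumR_plus; lra.
Qed.

Lemma abs_summable_scal (c : C) g : abs_summable g -> abs_summable (fun x => c * g x)%C.
Proof.
  intros [M HM]; exists (Cmod c * M); intros L Hn.
  rewrite (lsumR_ext _ (fun x => Cmod c * Cmod (g x))) by (intros; apply Cmod_mult).
  rewrite lsumR_scal. apply Rmult_le_compat_l; [apply Cmod_ge_0|apply HM, Hn].
Qed.

Lemma abs_summable_single (a : T) g : (forall x, x <> a -> g x = 0) -> abs_summable g.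
Proof.
  intros H; exists (Cmod (g a)); intros L Hn.
  destruct (excluded_middle_informative (In a L)) as [Ha|Ha].
  - destruct (incl_Permutation (a :: nil) L) as [L' HL'].
    + repeat constructor; simpl; tauto.
    + intros b [<-|[]]; exact Ha.
    + rewrite (lsumR_perm _ _ _ HL'); simpl.
      assert (Hn' : NoDup (a :: L')) by (apply (Permutation_NoDup HL' Hn)).
      inversion Hn' as [|? ? Ha' _]; subst.
      rewrite (lsumR_ext _ (fun _ => 0)), lsumR_0; [lra|].
      intros x Hx; rewrite H; [apply Cmod_0|]; intros ->; contradiction.
  - rewrite (lsumR_ext _ (fun _ => 0)), lsumR_0; [apply Cmod_ge_0|].
    intros x Hx; rewrite H; [apply Cmod_0|]; intros ->; contradiction.
Qed.

Lemma lsumC_RtoC (g : T -> R) L : lsumC (fun x => RtoC (g x)) L = RtoC (lsumR g L).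
Proof. induction L; simpl; [reflexivity|]. rewrite IHL, RtoC_plus; reflexivity. Qed.

Lemma has_usum_nonneg (g : T -> R) M :
  (forall x, 0 <= g x) -> (forall L, NoDup L -> lsumR g L <= M) ->
  exists s, has_usum (fun x => RtoC (g x)) (RtoC s).
Proof.
  intros Hg HM.
  (* The sum is the supremum of the finite partial sums. *)
  destruct (completeness (fun r => exists L, NoDup L /\ r = lsumR g L)) as [s [Hs1 Hs2]].
  - exists M; intros r [L [Hn ->]]; auto.
  - exists 0, nil; split; [constructor|reflexivity].
  - exists s; intros e He.
    assert (H : exists L, NoDup L /\ s - e < lsumR g L).
    { apply Classical_Prop.NNPP; intros H.
      assert (s <= s - e); [|lra]. apply Hs2; intros r [L [Hn ->]].
      apply Rnot_lt_le; intros Hlt; apply H; exists L; tauto. }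
    destruct H as [L0 [Hn0 HL0]]; exists L0; split; [exact Hn0|]; intros L Hn Hi.
    rewrite lsumC_RtoC, <- RtoC_minus, Cmod_R.
    assert (lsumR g L <= s) by (apply Hs1; exists L; tauto).
    generalize (lsumR_incl g L0 L Hg Hn0 Hi); intros.
    apply Rabs_def1; lra.
Qed.

(** Write [g] as [|g|] minus [|g| - g], two nonnegative families with bounded finite sums. *)
Lemma has_usum_real (g : T -> R) M :
  (forall L, NoDup L -> lsumR (fun x => Rabs (g x)) L <= M) ->
  exists s, has_usum (fun x => RtoC (g x)) s.
Proof.
  intros HM.
  destruct (has_usum_nonneg (fun x => Rabs (g x)) M) as [s Hs]; [intros; apply Rabs_pos|exact HM|].
  destruct (has_usum_nonneg (fun x => Rabs (g x) - g x) (M + M)) as [t Ht].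
  - intros x; generalize (Rle_abs (g x)); lra.
  - intros L Hn; specialize (HM L Hn).
    apply Rle_trans with (lsumR (fun x => Rabs (g x) + Rabs (g x)) L).
    + apply lsumR_le; intros x _. generalize (Rle_abs (- g x)); rewrite Rabs_Ropp; lra.
    + rewrite lsumR_plus; lra.
  - exists (s + (-1) * t)%C.
    apply has_usum_ext with (2 := has_usum_plus _ _ _ _ Hs (has_usum_scal (-1) _ _ Ht)).
    intros x; rewrite RtoC_minus; ring.
Qed.

(** Real and imaginary parts are summed separately. This justifies the choice in [usum]: on
    absolutely summable families it returns the genuine sum. *)
Lemma abs_summable_has_usum g : abs_summable g -> has_usum g (usum g).
Proof.
  intros [M HM]. unfold usum; apply epsilon_spec.
  destruct (has_usum_real (fun x => Re (g x)) M) as [s Hs].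
  - intros L Hn; eapply Rle_trans; [|apply (HM L Hn)]. apply lsumR_le; intros; apply re_le_Cmod.
  - destruct (has_usum_real (fun x => Im (g x)) M) as [t Ht].
    + intros L Hn; eapply Rle_trans; [|apply (HM L Hn)].
      apply lsumR_le; intros x _. eapply Rle_trans; [apply Rmax_r|apply Rmax_Cmod].
    + exists (s + Ci * t)%C.
      apply has_usum_ext with (2 := has_usum_plus _ _ _ _ Hs (has_usum_scal Ci _ _ Ht)).
      intros x. destruct (g x); unfold RtoC, Cplus, Cmult, Ci, Re, Im; simpl; f_equal; ring.
Qed.

Lemma usum_plus g h : abs_summable g -> abs_summable h ->
  usum (fun x => g x + h x)%C = (usum g + usum h)%C.
Proof. intros; apply usum_eq, has_usum_plus; apply abs_summable_has_usum; assumption. Qed.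

Lemma usum_scal (c : C) g : abs_summable g -> usum (fun x => c * g x)%C = (c * usum g)%C.
Proof. intros; apply usum_eq, has_usum_scal, abs_summable_has_usum; assumption. Qed.

Lemma usum_single (a : T) g : (forall x, x <> a -> g x = 0) -> usum g = g a.
Proof. intros; apply usum_eq, has_usum_single; assumption. Qed.

Lemma usum_approx g e : abs_summable g -> 0 < e ->
  exists L0, NoDup L0 /\ forall L, NoDup L -> incl L0 L -> Cmod (usum g - lsumC g L) < e.
Proof.
  intros Hg He. destruct (abs_summable_has_usum g Hg e He) as [L0 [Hn H]].
  exists L0; split; [exact Hn|]; intros L H1 H2.
  replace (usum g - lsumC g L)%C with (- (lsumC g L - usum g))%C by ring.
  rewrite Cmod_opp; auto.
Qed.

End InfiniteSums.

(** * Geodesics from the root, children and branches *)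

Section Tree.
Context {T : Type} (adj : T -> T -> Prop) (o : T) (Htree : is_tree adj).

Local Notation geo := (geo adj o).
Local Notation is_child := (is_child adj o).

Lemma chain_prefix l l' : chain adj (l ++ l') -> chain adj l.
Proof.
  induction l as [|a [|b l] IH]; simpl in *; tauto.
Qed.

Lemma no_backtrack_prefix (l l' : list T) : no_backtrack (l ++ l') -> no_backtrack l.
Proof.
  induction l as [|a [|b [|c l]] IH]; simpl in *; tauto.
Qed.

Lemma chain_snoc l a b : chain adj (l ++ a :: nil) -> adj a b -> chain adj (l ++ a :: b :: nil).
Proof.
  induction l as [|c [|d l] IH]; simpl in *; tauto.
Qed.

Lemma chain_last l a b : chain adj (l ++ a :: b :: nil) -> adj a b.
Proof.
  induction l as [|c [|d l] IH]; simpl in *; tauto.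
Qed.

Lemma no_backtrack_snoc (l : list T) a b c :
  no_backtrack (l ++ a :: b :: nil) -> a <> c -> no_backtrack (l ++ a :: b :: c :: nil).
Proof.
  induction l as [|d [|e [|f l]] IH]; simpl in *; tauto.
Qed.

Lemma geo_spec x : reduced_path adj o x (geo x).
Proof.
  unfold Defs.geo; apply epsilon_spec.
  destruct (proj2 (proj2 Htree) o x) as [l [Hl _]]; exists l; exact Hl.
Qed.

Lemma geo_unique x l : reduced_path adj o x l -> geo x = l.
Proof.
  intros H; destruct (proj2 (proj2 Htree) o x) as [l' [_ Hl']].
  rewrite <- (Hl' _ (geo_spec x)), <- (Hl' _ H); reflexivity.
Qed.

Lemma geo_decomp x : exists l, geo x = l ++ x :: nil.
Proof.
  destruct (geo_spec x) as [H1 [H2 _]]. destruct (geo x) as [|a l]; [discriminate|].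
  destruct (@exists_last _ (a :: l)) as [l' [b Hb]]; [discriminate|].
  rewrite Hb in *. rewrite last_last in H2; subst b. exists l'; reflexivity.
Qed.

(** A prefix of a reduced path is reduced, so uniqueness of reduced paths makes it the geodesic to
    its last vertex. *)
Lemma geo_prefix_reduced x l y l' : geo x = l ++ y :: l' -> geo y = l ++ y :: nil.
Proof.
  intros H. destruct (geo_spec x) as [H1 [_ [H3 H4]]]. rewrite H in *.
  replace (l ++ y :: l') with ((l ++ y :: nil) ++ l') in * by (rewrite <- app_assoc; reflexivity).
  apply geo_unique; repeat split.
  - destruct l; simpl in *; exact H1.
  - apply last_last.
  - apply (chain_prefix _ _ H3).
  - apply (no_backtrack_prefix _ _ H4).
Qed.

Lemma geo_o : geo o = o :: nil.
Proof. apply geo_unique; repeat split. Qed.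

Lemma geo_inj x y : geo x = geo y -> x = y.
Proof.
  destruct (geo_spec x) as [_ [Hx _]], (geo_spec y) as [_ [Hy _]]. congruence.
Qed.

Lemma geo_step_ne_o x y : geo y = geo x ++ y :: nil -> y <> o.
Proof.
  intros H ->. rewrite geo_o in H. destruct (geo_decomp x) as [l Hl].
  rewrite Hl in H. apply (f_equal (@length T)) in H.
  rewrite !length_app in H; simpl in H; lia.
Qed.

Lemma geo_pred y : y <> o ->
  adj (pred_v adj o y) y /\ geo y = geo (pred_v adj o y) ++ y :: nil.
Proof.
  intros Hy. destruct (geo_decomp y) as [l Hl].
  destruct l as [|a l0] using rev_ind.
  - exfalso; apply Hy. destruct (geo_spec y) as [H _]. rewrite Hl in H; simpl in H; congruence.
  - clear IHl0. rewrite <- app_assoc in Hl; simpl in Hl.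
    assert (Ha : pred_v adj o y = a).
    { unfold pred_v; rewrite Hl, length_app; simpl.
      replace (length l0 + 2 - 2)%nat with (length l0) by lia. apply nth_middle. }
    rewrite Ha. split.
    + destruct (geo_spec y) as [_ [_ [H _]]]. rewrite Hl in H. apply (chain_last _ _ _ H).
    + rewrite (geo_prefix_reduced _ _ _ _ Hl), <- app_assoc; exact Hl.
Qed.

(** Turns parenthood into an equation between lists. The condition [y <> o] is implicit on the
    right: that list has length at least two, while [geo o] has length one. *)
Lemma child_iff y x : is_child y x <-> geo y = geo x ++ y :: nil.
Proof.
  split.
  - intros [Hy <-]. apply geo_pred, Hy.
  - intros H. assert (Hy := geo_step_ne_o _ _ H). split; [exact Hy|].
    destruct (geo_pred y Hy) as [_ H2]. rewrite H in H2.
    apply app_inj_tail in H2. symmetry; apply geo_inj, H2.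
Qed.

Lemma child_adj y x : is_child y x -> adj x y.
Proof. intros [Hy <-]. apply geo_pred, Hy. Qed.

Lemma child_parent_unique y x x' : is_child y x -> is_child y x' -> x = x'.
Proof. intros [_ <-] [_ <-]; reflexivity. Qed.

Lemma child_length y x : is_child y x -> length (geo y) = S (length (geo x)).
Proof. intros H; apply child_iff in H; rewrite H, length_app; simpl; lia. Qed.

Lemma child_asym y x : is_child y x -> ~ is_child x y.
Proof. intros H H'; apply child_length in H; apply child_length in H'; lia. Qed.

(** If [y] is the last but one vertex of the geodesic to [x], it is the parent; otherwise appending
    [y] causes no backtracking, and uniqueness identifies the longer path with [geo y]. *)
Lemma adj_child x y : adj x y -> is_child y x \/ is_child x y.
Proof.
  intros Hxy. destruct (geo_decomp x) as [l Hl].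
  destruct (geo_spec x) as [H1 [_ [H3 H4]]].
  destruct l as [|z l] using rev_ind.
  - left. apply child_iff. apply geo_unique. rewrite Hl in *; simpl in *.
    repeat split; assumption.
  - clear IHl. rewrite <- app_assoc in Hl; simpl in Hl.
    destruct (eq_dec_classical z y) as [->|Hz].
    + right. apply child_iff. rewrite (geo_prefix_reduced _ _ _ _ Hl), <- app_assoc; exact Hl.
    + left. apply child_iff. apply geo_unique. rewrite Hl in *.
      repeat split.
      * destruct l; simpl in *; assumption.
      * apply last_last.
      * rewrite <- app_assoc; simpl.
        replace (l ++ z :: x :: y :: nil) with ((l ++ z :: nil) ++ x :: y :: nil)
          by (rewrite <- app_assoc; reflexivity).
        apply chain_snoc; [rewrite <- app_assoc|]; assumption.
      * rewrite <- app_assoc; simpl. apply no_backtrack_snoc; assumption.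
Qed.

Lemma tree_ind (Q : T -> Prop) :
  Q o -> (forall x y, is_child y x -> Q x -> Q y) -> forall x, Q x.
Proof.
  intros Ho Hs x. remember (length (geo x)) as n eqn:Hn. revert x Hn.
  induction n as [n IH] using (well_founded_induction Wf_nat.lt_wf); intros x Hn.
  destruct (eq_dec_classical x o) as [->|Hx]; [exact Ho|].
  assert (Hc : is_child x (pred_v adj o x)) by (split; [exact Hx|reflexivity]).
  apply (Hs _ _ Hc). apply (IH (length (geo (pred_v adj o x)))); [|reflexivity].
  apply child_length in Hc; lia.
Qed.

Lemma In_geo_self x : In x (geo x).
Proof. destruct (geo_decomp x) as [l ->]; apply in_or_app; simpl; tauto. Qed.

Lemma geo_prefix y x : In y (geo x) -> exists l, geo x = geo y ++ l.
Proof.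
  intros H; apply in_split in H; destruct H as [l [l' H]].
  exists l'. rewrite (geo_prefix_reduced _ _ _ _ H), <- app_assoc; exact H.
Qed.

Lemma In_geo_trans x y z : In x (geo y) -> In y (geo z) -> In x (geo z).
Proof. intros H1 H2; destruct (geo_prefix _ _ H2) as [l ->]; apply in_or_app; tauto. Qed.

Lemma child_not_In y x : is_child y x -> ~ In y (geo x).
Proof.
  intros Hc H; apply child_length in Hc. destruct (geo_prefix _ _ H) as [l Hl].
  rewrite Hl, length_app in Hc; lia.
Qed.

Lemma geo_NoDup x : NoDup (geo x).
Proof.
  revert x; apply tree_ind.
  - rewrite geo_o; repeat constructor; simpl; tauto.
  - intros x y Hc H. rewrite (proj1 (child_iff _ _) Hc).
    apply NoDup_app; [exact H|repeat constructor; simpl; tauto|].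
    intros a Ha [<-|[]]. apply (child_not_In _ _ Hc Ha).
Qed.

Lemma In_geo_child v y x : is_child y x -> (In v (geo y) <-> In v (geo x) \/ v = y).
Proof.
  intros Hc; rewrite (proj1 (child_iff _ _) Hc), in_app_iff; simpl.
  split; intros [H|H]; auto; destruct H; auto; contradiction.
Qed.

(** The edge between [y] and its parent is the only exit from the branch at [y], the set of vertices
    whose geodesic contains [y]. Cutting a function off outside the branch therefore changes [P]
    across this edge only. *)
Lemma branch_cross y x a b : is_child y x -> adj a b ->
  In y (geo a) -> ~ In y (geo b) -> a = y /\ b = x.
Proof.
  intros Hc Hab Ha Hb. destruct (adj_child _ _ Hab) as [H|H].
  - exfalso; apply Hb. apply (In_geo_child _ _ _ H); tauto.
  - apply (In_geo_child _ _ _ H) in Ha. destruct Ha as [Ha|<-]; [contradiction|].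
    split; [reflexivity|]. apply (child_parent_unique _ _ _ H Hc).
Qed.

(** Both geodesics are prefixes of [geo x] of the same length. *)
Lemma child_In_unique x v c c' :
  is_child c v -> is_child c' v -> In c (geo x) -> In c' (geo x) -> c = c'.
Proof.
  intros H H' Hc Hc'. apply child_length in H; apply child_length in H'.
  destruct (geo_prefix _ _ Hc) as [l Hl], (geo_prefix _ _ Hc') as [l' Hl'].
  apply geo_inj. rewrite Hl in Hl'.
  assert (E : length (geo c) = length (geo c')) by lia.
  apply (f_equal (firstn (length (geo c)))) in Hl'.
  rewrite firstn_app, Nat.sub_diag, firstn_all in Hl'.
  rewrite E, firstn_app, Nat.sub_diag, firstn_all in Hl'.
  simpl in Hl'. rewrite !app_nil_r in Hl'. exact Hl'.
Qed.

Lemma ray_geo xi k : ray adj o xi -> geo (xi k) = map xi (seq 0 (S k)).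
Proof.
  intros [H0 H]. apply geo_unique. repeat split.
  - simpl; congruence.
  - rewrite seq_S, map_app; apply last_last.
  - generalize (S k) at 1; intros n. generalize 0%nat. induction n as [|[|n] IH]; intros i; simpl; auto.
    split; [apply H|]. apply (IH (S i)).
  - generalize (S k) at 1; intros n. generalize 0%nat.
    induction n as [|[|[|n]] IH]; intros i; simpl; auto.
    split; [apply H|]. apply (IH (S i)).
Qed.

Lemma ray_child xi k : ray adj o xi -> is_child (xi (S k)) (xi k).
Proof. intros H; apply child_iff. rewrite !ray_geo by exact H. rewrite (seq_S (S k)), map_app; reflexivity. Qed.

Lemma child_seq_ray xi :
  xi 0%nat = o -> (forall k, is_child (xi (S k)) (xi k)) -> ray adj o xi.
Proof.
  intros H0 H; split; [exact H0|]; intros k; split; [apply child_adj, H|].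
  intros E. assert (H1 := child_length _ _ (H k)). assert (H2 := child_length _ _ (H (S k))).
  rewrite <- E in H2; lia.
Qed.

(** * Existence of ends, and the ends selected by [pick_end] *)

Section Ends.
Hypothesis (Hnl : no_leaves adj) (Hnb : forall x, exists y, adj x y).

(** A vertex without children would have its parent as its only neighbour. [no_leaves] excludes
    exactly one neighbour but not none, hence the hypothesis [Hnb]. *)
Lemma exists_child x : exists y, is_child y x.
Proof.
  destruct (Hnb x) as [y0 H0]. destruct (adj_child _ _ H0) as [|H0']; [eauto|].
  apply Classical_Prop.NNPP; intros Hno. apply (Hnl x). exists y0; split; [exact H0|].
  intros y Hy. destruct (adj_child _ _ Hy) as [H|H]; [exfalso; eauto|].
  apply (child_parent_unique _ _ _ H0' H).
Qed.

Lemma exists_end v : exists xi, ray adj o xi /\ through xi v.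
Proof.
  destruct (choice (fun x y => is_child y x) exists_child) as [s Hs].
  (* Stated for every descending sequence [zeta] from [v], so that the induction can prepend the
     parent until the root is reached; [k] counts the prepended vertices. *)
  assert (H : forall v zeta, zeta 0%nat = v -> (forall k, is_child (zeta (S k)) (zeta k)) ->
    exists xi, (xi 0%nat = o /\ forall k, is_child (xi (S k)) (xi k)) /\
      exists k, forall j, xi (k + j)%nat = zeta j).
  { clear v. intros v; induction v as [|x y Hc IH] using tree_ind; intros zeta H1 H2.
    - exists zeta; split; [tauto|]. exists 0%nat; reflexivity.
    - destruct (IH (fun k => match k with O => x | S k' => zeta k' end)) as [xi [Hxi [k Hk]]].
      + reflexivity.
      + intros [|k]; [rewrite H1; exact Hc|apply H2].
      + exists xi; split; [exact Hxi|]. exists (S k); intros j.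
        specialize (Hk (S j)); simpl in Hk. rewrite <- Hk; f_equal; lia. }
  destruct (H v (fun k => Nat.iter k s v)) as [xi [[H1 H2] [k Hk]]].
  - reflexivity.
  - intros k; apply Hs.
  - exists xi; split; [apply child_seq_ray; assumption|]. exists (k + 0)%nat. rewrite Hk; reflexivity.
Qed.

Lemma meet_aux_map (xi : nat -> T) n i (cur : T) l :
  meet_aux (map xi (seq i (S n)) ++ l) xi i cur = meet_aux l xi (i + S n) (xi (i + n)%nat).
Proof.
  revert i cur; induction n as [|n IH]; intros i cur.
  - simpl. rewrite decide_true by reflexivity.
    replace (i + 1)%nat with (S i) by lia. rewrite Nat.add_0_r. reflexivity.
  - change (map xi (seq i (S (S n)))) with (xi i :: map xi (seq (S i) (S n))).
    cbn [app meet_aux]. rewrite decide_true by reflexivity. rewrite IH.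
    f_equal; [lia|f_equal; lia].
Qed.

(* A vertex on the path to [x] whose only child is also on that path carries no end
   leaving the path there; [pick_end] is then arbitrary. *)
Lemma meet_pick_end x v : In v (geo x) ->
  meet adj o x (pick_end adj o (geo x) v) = v \/
  (exists c, is_child c v /\ In c (geo x) /\ forall c', is_child c' v -> c' = c).
Proof.
  intros Hv.
  destruct (excluded_middle_informative (exists c, is_child c v /\ ~ In c (geo x))) as [[c [Hc Hcx]]|Hno].
  - left.
    assert (Hex : exists xi, ray adj o xi /\ through xi v /\
       forall y, In y (geo x) -> is_child y v -> ~ through xi y).
    (* An end through a child off the path avoids the children on the path, because a ray has one
       vertex at each distance from [o]. *)
    { destruct (exists_end c) as [xi [Hxi [k Hk]]]. exists xi; split; [exact Hxi|].
      assert (Hlen : forall j, length (geo (xi j)) = S j)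
        by (intros j; rewrite ray_geo, length_map, length_seq by exact Hxi; reflexivity).
      destruct k as [|k].
      - exfalso. destruct Hc as [Hc _]. apply Hc. rewrite <- Hk; apply Hxi.
      - assert (Hkv : xi k = v).
        { assert (H := ray_child xi k Hxi). rewrite Hk in H. apply (child_parent_unique _ _ _ H Hc). }
        split; [exists k; exact Hkv|].
        intros y Hy Hyv [j Hj]. apply Hcx. replace c with y; [exact Hy|].
        apply child_length in Hyv. rewrite <- Hj, <- Hkv, !Hlen in Hyv.
        injection Hyv as ->. congruence. }
    assert (Hp := epsilon_spec (inhabits (fun _ : nat => o)) _ Hex).
    unfold meet, pick_end.
    set (xi := epsilon _ _) in *. destruct Hp as [Hxi [[k Hk] Hav]].
    destruct (geo_prefix _ _ Hv) as [l Hl]. rewrite Hl.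
    rewrite <- Hk at 1. rewrite ray_geo by exact Hxi. rewrite meet_aux_map. simpl.
    destruct l as [|d l]; simpl; [exact Hk|].
    rewrite decide_false; [exact Hk|]. intros Hd.
    assert (Hdx : In d (geo x)) by (rewrite Hl; apply in_or_app; simpl; tauto).
    apply (Hav d Hdx); [|exists (S k); auto].
    apply child_iff. apply (geo_prefix_reduced _ _ _ _ Hl).
  - right. assert (Hall : forall c, is_child c v -> In c (geo x)).
    { intros c Hc; apply Classical_Prop.NNPP; intros H; apply Hno; eauto. }
    destruct (exists_child v) as [c Hc]. exists c; repeat split; auto; try apply Hc.
    intros c' Hc'. apply (child_In_unique x v); auto.
Qed.

End Ends.
End Tree.

(** * Linearity of [P] and of [mu - P] on functions with absolutely convergent averages *)

Section TransitionOperator.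
Context {T : Type} (p : T -> T -> R).
Local Open Scope C_scope.

Definition p_summable (f : T -> C) : Prop :=
  forall x, abs_summable (fun y => RtoC (p x y) * f y).

Lemma p_summable_ext f g : (forall x, f x = g x) -> p_summable f -> p_summable g.
Proof. intros H; replace g with f; [tauto|]. apply functional_extensionality, H. Qed.

Lemma p_summable_plus f g : p_summable f -> p_summable g -> p_summable (fun x => f x + g x).
Proof.
  intros Hf Hg x. eapply abs_summable_ext; [|apply (abs_summable_plus _ _ (Hf x) (Hg x))].
  intros y; simpl; ring.
Qed.

Lemma p_summable_scal c f : p_summable f -> p_summable (fun x => c * f x).
Proof.
  intros Hf x. eapply abs_summable_ext; [|apply (abs_summable_scal c _ (Hf x))].
  intros y; simpl; ring.
Qed.

Lemma Pop_plus f g x : p_summable f -> p_summable g ->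
  Pop p (fun x => f x + g x) x = Pop p f x + Pop p g x.
Proof.
  intros Hf Hg. unfold Pop. rewrite <- (usum_plus _ _ (Hf x) (Hg x)).
  apply usum_ext; intros; ring.
Qed.

Lemma Pop_scal c f x : p_summable f -> Pop p (fun x => c * f x) x = c * Pop p f x.
Proof.
  intros Hf. unfold Pop. rewrite <- (usum_scal c _ (Hf x)).
  apply usum_ext; intros; ring.
Qed.

Lemma Lap_ext mu f g x : (forall x, f x = g x) -> Lap p mu f x = Lap p mu g x.
Proof. intros H; replace g with f; [reflexivity|]. apply functional_extensionality, H. Qed.

Lemma Lap_plus mu f g x : p_summable f -> p_summable g ->
  Lap p mu (fun x => f x + g x) x = Lap p mu f x + Lap p mu g x.
Proof. intros; unfold Lap; rewrite Pop_plus by assumption; ring. Qed.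

Lemma Lap_scal mu c f x : p_summable f -> Lap p mu (fun x => c * f x) x = c * Lap p mu f x.
Proof. intros; unfold Lap; rewrite Pop_scal by assumption; ring. Qed.

Lemma Lap_lin mu c f g x : p_summable f -> p_summable g ->
  Lap p mu (fun x => f x + c * g x) x = Lap p mu f x + c * Lap p mu g x.
Proof.
  intros Hf Hg. rewrite Lap_plus, Lap_scal; auto using p_summable_scal.
Qed.

Lemma Lap_shift mu nu f x : Lap p mu f x = Lap p nu f x + (mu - nu) * f x.
Proof. unfold Lap; ring. Qed.

End TransitionOperator.

(** * The space l^2(T, m), contractivity of [P] and completeness *)

Section WeightedSpace.
Context {T : Type} (adj : T -> T -> Prop) (o : T) (p : T -> T -> R).
Hypothesis (Htree : is_tree adj) (Hst : stochastic adj p).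

Local Notation m := (mes adj o p).

Lemma mprod_snoc l a b :
  mprod p (l ++ a :: b :: nil) = mprod p (l ++ a :: nil) * (p a b / p b a).
Proof.
  induction l as [|c [|d l] IH]; simpl in *; [ring|ring|].
  rewrite IH; ring.
Qed.

Lemma mes_o : m o = 1.
Proof. unfold mes; rewrite geo_o by assumption; reflexivity. Qed.

Lemma mes_child x y : is_child adj o y x -> m y = m x * (p x y / p y x).
Proof.
  intros H; unfold mes. rewrite (proj1 (child_iff adj o Htree _ _) H).
  destruct (geo_decomp adj o Htree x) as [l ->]. rewrite <- app_assoc. apply mprod_snoc.
Qed.

Lemma p_pos x y : adj x y -> 0 < p x y.
Proof. intros; apply Hst; assumption. Qed.

Lemma p_nonneg x y : 0 <= p x y.
Proof. apply Hst. Qed.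

Lemma p_nonadj x y : ~ adj x y -> p x y = 0.
Proof.
  intros H. destruct (p_nonneg x y) as [H'|H']; [|congruence].
  exfalso; apply H, Hst, H'.
Qed.

Lemma child_adj' x y : is_child adj o y x -> adj y x.
Proof. intros H; apply Htree, (child_adj adj o Htree), H. Qed.

Lemma mes_pos x : 0 < m x.
Proof.
  induction x as [|x y Hc IH] using (tree_ind adj o Htree); [rewrite mes_o; lra|].
  rewrite (mes_child _ _ Hc). apply Rmult_lt_0_compat; [exact IH|].
  apply Rdiv_lt_0_compat; apply p_pos; [apply (child_adj adj o Htree)|apply child_adj']; exact Hc.
Qed.

Lemma reversible x y : m x * p x y = m y * p y x.
Proof.
  destruct (excluded_middle_informative (adj x y)) as [Hxy|Hxy].
  - assert (Hyx : adj y x) by (apply Htree, Hxy).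
    assert (H1 := p_pos _ _ Hxy). assert (H2 := p_pos _ _ Hyx).
    destruct (adj_child adj o Htree _ _ Hxy) as [H|H]; rewrite (mes_child _ _ H); field; lra.
  - rewrite !p_nonadj; [ring| |exact Hxy]. intros H; apply Hxy, Htree, H.
Qed.

Lemma p_sum_le_1 x L : NoDup L -> lsumR (p x) L <= 1.
Proof.
  intros Hn. destruct Hst as [H0 [_ H1]]. destruct (H1 x) as [Hs Hu].
  assert (H := abs_summable_has_usum _ Hs). rewrite Hu in H.
  apply Rnot_lt_le; intros Hlt.
  destruct (H (lsumR (p x) L - 1)) as [L0 [Hn0 HL0]]; [lra|].
  destruct (NoDup_join L0 L) as [L1 [Hn1 [Hi0 Hi1]]].
  specialize (HL0 L1 Hn1 Hi0). rewrite lsumC_RtoC, <- RtoC_minus, Cmod_R in HL0.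
  apply Rabs_def2 in HL0. generalize (lsumR_incl (p x) L L1 (H0 x) Hn Hi1); lra.
Qed.

Definition sqnorm_on (L : list T) (u : T -> C) : R := lsumR (fun x => Cmod (u x) ^ 2 * m x) L.

(* "The norm of [u] in l^2(T, m) is at most [A]", for a positive number [A]. *)
Definition bnd (u : T -> C) (A : R) : Prop :=
  0 < A /\ forall L, NoDup L -> sqnorm_on L u <= A ^ 2.

Lemma l2_bnd u : l2 adj o p u <-> exists A, bnd u A.
Proof.
  assert (E : forall L, lsumR (fun a => Cmod (RtoC (Cmod (u a) ^ 2 * m a))) L = sqnorm_on L u).
  { intros L; apply lsumR_ext; intros x _. rewrite Cmod_R, Rabs_pos_eq; [reflexivity|].
    apply Rmult_le_pos; [apply pow2_ge_0|apply Rlt_le, mes_pos]. }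
  split.
  - intros [M HM]. exists (Rabs M + 1). split; [generalize (Rabs_pos M); lra|].
    intros L Hn. specialize (HM L Hn). rewrite E in HM.
    generalize (Rle_abs M) (Rabs_pos M); nra.
  - intros [A [_ HA]]. exists (A ^ 2). intros L Hn. rewrite E. apply HA, Hn.
Qed.

Lemma bnd_pos u A : bnd u A -> 0 < A.
Proof. intros H; apply H. Qed.

Lemma bnd_ext u v A : (forall x, u x = v x) -> bnd u A -> bnd v A.
Proof. intros H; replace v with u; [tauto|]. apply functional_extensionality, H. Qed.

Lemma bnd_weaken u A B : A <= B -> bnd u A -> bnd u B.
Proof. intros H [H1 H2]; split; [lra|]. intros L Hn; specialize (H2 L Hn); nra. Qed.

(** With the weight [t = B / A] chosen below, this gives the triangle inequality for the norm
    without Cauchy-Schwarz. *)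
Lemma Cmod_plus_sq t a b : 0 < t ->
  Cmod (a + b) ^ 2 <= (1 + t) * Cmod a ^ 2 + (1 + / t) * Cmod b ^ 2.
Proof.
  intros Ht. assert (H := Cmod_triangle a b).
  apply Rle_trans with ((Cmod a + Cmod b) ^ 2).
  - apply pow_incr; split; [apply Cmod_ge_0|exact H].
  - assert (0 <= (t * Cmod a - Cmod b) ^ 2 / t)
      by (apply Rmult_le_pos; [apply pow2_ge_0|apply Rlt_le, Rinv_0_lt_compat, Ht]).
    replace ((1 + t) * Cmod a ^ 2 + (1 + / t) * Cmod b ^ 2)
      with ((Cmod a + Cmod b) ^ 2 + (t * Cmod a - Cmod b) ^ 2 / t) by (field; lra).
    lra.
Qed.

Lemma sqnorm_on_plus L u v A B : 0 < A -> 0 < B ->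
  sqnorm_on L u <= A ^ 2 -> sqnorm_on L v <= B ^ 2 ->
  sqnorm_on L (fun x => u x + v x)%C <= (A + B) ^ 2.
Proof.
  intros HA HB Hu Hv. assert (Ht : 0 < B / A) by (apply Rdiv_lt_0_compat; assumption).
  apply Rle_trans with ((1 + B / A) * sqnorm_on L u + (1 + / (B / A)) * sqnorm_on L v).
  - unfold sqnorm_on. rewrite <- !lsumR_scal, <- lsumR_plus. apply lsumR_le; intros x _.
    generalize (Cmod_plus_sq _ (u x) (v x) Ht) (mes_pos x); nra.
  - replace ((A + B) ^ 2) with ((1 + B / A) * A ^ 2 + (1 + / (B / A)) * B ^ 2) by (field; lra).
    assert (0 < / (B / A)) by (apply Rinv_0_lt_compat, Ht).
    apply Rplus_le_compat; apply Rmult_le_compat_l; lra.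
Qed.

Lemma bnd_plus u v A B : bnd u A -> bnd v B -> bnd (fun x => u x + v x)%C (A + B).
Proof.
  intros [HA Hu] [HB Hv]; split; [lra|]. intros L Hn. apply sqnorm_on_plus; auto.
Qed.

Lemma bnd_scal c u A B : 0 < B -> Cmod c * A <= B -> bnd u A -> bnd (fun x => c * u x)%C B.
Proof.
  intros HB Hc [HA Hu]; split; [exact HB|]. intros L Hn.
  apply Rle_trans with (Cmod c ^ 2 * sqnorm_on L u).
  - unfold sqnorm_on. rewrite <- lsumR_scal. apply lsumR_le; intros x _. rewrite Cmod_mult.
    apply Req_le; ring.
  - apply Rle_trans with (Cmod c ^ 2 * A ^ 2).
    + apply Rmult_le_compat_l; [apply pow2_ge_0|auto].
    + rewrite <- Rpow_mult_distr. apply pow_incr; split; [|exact Hc].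
      apply Rmult_le_pos; [apply Cmod_ge_0|lra].
Qed.

Lemma bnd_minus u v A B : bnd u A -> bnd v B -> bnd (fun x => u x - v x)%C (A + B).
Proof.
  intros Hu Hv. apply bnd_ext with (fun x => u x + (-1) * v x)%C; [intros; ring|].
  apply bnd_plus; [exact Hu|]. apply bnd_scal with B; [apply Hv| |exact Hv].
  replace (RtoC (-1)) with (- (1))%C by (rewrite <- RtoC_opp; reflexivity).
  rewrite Cmod_m1; lra.
Qed.

Lemma bnd_0 A : 0 < A -> bnd (fun _ => 0%C) A.
Proof.
  intros HA; split; [exact HA|]. intros L _. unfold sqnorm_on.
  rewrite (lsumR_ext _ (fun _ => 0)), lsumR_0; [apply pow2_ge_0|].
  intros; rewrite Cmod_0; ring.
Qed.

Lemma bnd_point u A x : bnd u A -> Cmod (u x) <= A * / sqrt (m x).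
Proof.
  intros [HA Hu]. specialize (Hu (x :: nil)). unfold sqnorm_on in Hu; simpl in Hu.
  assert (Hm := mes_pos x). assert (Hs := sqrt_lt_R0 _ Hm).
  assert (E := sqrt_sqrt (m x) (Rlt_le _ _ Hm)).
  apply Rmult_le_reg_r with (sqrt (m x)); [exact Hs|].
  rewrite Rmult_assoc, Rinv_l, Rmult_1_r by lra.
  apply Rsqr_incr_0_var; [|lra]. unfold Rsqr.
  assert (NoDup (x :: nil)) by (repeat constructor; simpl; tauto).
  specialize (Hu H). rewrite <- E in Hu. lra.
Qed.

Lemma bnd_indicator y : bnd (indicator y) (sqrt (m y)).
Proof.
  assert (Hm := mes_pos y). split; [apply sqrt_lt_R0, Hm|]. intros L Hn.
  rewrite pow2_sqrt by lra.
  assert (E : sqnorm_on L (indicator y) = Cmod (lsumC (fun x => RtoC (if decide (x = y) then m y else 0)) L)).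
  { rewrite lsumC_RtoC, Cmod_R, Rabs_pos_eq.
    - apply lsumR_ext; intros x _. unfold indicator. case_decide.
      + subst x. rewrite Cmod_1; ring.
      + rewrite Cmod_0; ring.
    - apply lsumR_ge_0; intros; case_decide; lra. }
  rewrite E; clear E.
  destruct (excluded_middle_informative (In y L)) as [Hy|Hy].
  - rewrite (lsumC_single _ y L Hn Hy).
    + rewrite decide_true, Cmod_R, Rabs_pos_eq by (reflexivity || lra). lra.
    + intros x Hx; rewrite decide_false by exact Hx; reflexivity.
  - rewrite (lsumC_ext _ (fun _ => RtoC 0)), lsumC_0, Cmod_0; [lra|].
    intros x Hx. rewrite decide_false; [reflexivity|]. intros ->; contradiction.
Qed.

Lemma sq_le_of_all_plus q A : 0 < A -> (forall B, 0 < B -> q <= (A + B) ^ 2) -> q <= A ^ 2.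
Proof.
  intros HA H. apply Rnot_lt_le; intros Hlt.
  assert (Hq : 0 < q) by nra. assert (Hs := sqrt_sqrt q (Rlt_le _ _ Hq)).
  assert (A < sqrt q) by (apply Rsqr_incrst_0; unfold Rsqr; [lra|lra|apply sqrt_pos]).
  specialize (H ((sqrt q - A) / 2)). nra.
Qed.

(** Lower semicontinuity of the norm under convergence on finite sets, in the manner of Fatou. On
    [L], of total mass [S], an error below [B / sqrt (S + 1)] at each vertex has norm at most [B],
    and [B] is arbitrary. *)
Lemma bnd_lsc u A : 0 < A ->
  (forall L e, 0 < e -> exists v, bnd v A /\ forall x, In x L -> Cmod (u x - v x) <= e) ->
  bnd u A.
Proof.
  intros HA H; split; [exact HA|]. intros L Hn. apply sq_le_of_all_plus; [exact HA|].
  intros B HB.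
  set (S := lsumR m L). assert (HS : 0 <= S) by (apply lsumR_ge_0; intros; apply Rlt_le, mes_pos).
  assert (Hq : 0 < sqrt (S + 1)) by (apply sqrt_lt_R0; lra).
  destruct (H L (B / sqrt (S + 1))) as [v [Hv Huv]]; [apply Rdiv_lt_0_compat; assumption|].
  replace u with (fun x => v x + (u x - v x))%C
    by (apply functional_extensionality; intros; ring).
  apply sqnorm_on_plus; [exact HA|exact HB|apply Hv, Hn|].
  apply Rle_trans with (lsumR (fun x => (B / sqrt (S + 1)) ^ 2 * m x) L).
  - apply lsumR_le; intros x Hx. apply Rmult_le_compat_r; [apply Rlt_le, mes_pos|].
    apply pow_incr; split; [apply Cmod_ge_0|apply Huv, Hx].
  - rewrite lsumR_scal. fold S. unfold Rdiv. rewrite Rpow_mult_distr, pow_inv, pow2_sqrt by lra.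
    apply Rle_trans with (B ^ 2 * (/ (S + 1) * (S + 1))).
    + rewrite Rmult_assoc. apply Rmult_le_compat_l; [apply pow2_ge_0|].
      apply Rmult_le_compat_l; [apply Rlt_le, Rinv_0_lt_compat|]; lra.
    + rewrite Rinv_l by lra; lra.
Qed.

Lemma bnd_limit u A : 0 < A -> (forall e, 0 < e -> bnd u (A + e)) -> bnd u A.
Proof.
  intros HA H; split; [exact HA|]. intros L Hn. apply sq_le_of_all_plus; [exact HA|].
  intros B HB; apply (H B HB); exact Hn.
Qed.

Lemma bnd_small_0 u x : (forall e, 0 < e -> bnd u e) -> u x = 0%C.
Proof.
  intros H. apply Cmod_eq_0. apply Rle_antisym; [|apply Cmod_ge_0].
  apply Rnot_lt_le; intros Hlt.
  assert (Hs : 0 < sqrt (m x)) by apply sqrt_lt_R0, mes_pos.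
  assert (Hp := bnd_point u (Cmod (u x) * sqrt (m x) / 2) x).
  replace (Cmod (u x) * sqrt (m x) / 2 * / sqrt (m x)) with (Cmod (u x) / 2) in Hp by (field; lra).
  assert (Cmod (u x) <= Cmod (u x) / 2); [|lra].
  apply Hp, H. apply Rdiv_lt_0_compat; [apply Rmult_lt_0_compat|]; lra.
Qed.

(** Cauchy-Schwarz with weights [w], hence Jensen's inequality when the total weight is at most 1.
    The inductive step needs [2 s t <= P t^2 + Q], which follows from [s^2 <= P Q] and
    [(P t^2 - Q)^2 >= 0]. *)
Lemma jensen_finite (w x : T -> R) L : (forall y, 0 <= w y) ->
  lsumR (fun y => w y * x y) L ^ 2 <= lsumR w L * lsumR (fun y => w y * x y ^ 2) L.
Proof.
  intros Hw. induction L as [|a L IH]; simpl; [lra|].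
  set (s := lsumR (fun y => w y * x y) L) in *.
  set (P := lsumR w L) in *. set (Q := lsumR (fun y => w y * (x y * (x y * 1))) L) in *.
  change (lsumR (fun y => w y * x y ^ 2) L) with Q in IH.
  assert (HP : 0 <= P) by (apply lsumR_ge_0, Hw).
  assert (HQ : 0 <= Q).
  { apply lsumR_ge_0; intros y. apply Rmult_le_pos; [apply Hw|]. nra. }
  specialize (Hw a). set (t := x a). set (v := w a) in *.
  assert (Ht : 0 <= t * t) by apply Rle_0_sqr.
  assert (HPt : 0 <= P * (t * t)) by (apply Rmult_le_pos; assumption).
  assert (H1 : s * s * (t * t) <= P * Q * (t * t)) by (apply Rmult_le_compat_r; lra).
  assert (H2 : 2 * s * t <= P * (t * t) + Q).
  { apply Rsqr_incr_0_var; [|lra]. unfold Rsqr.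
    assert (H3 := Rle_0_sqr (P * (t * t) - Q)). unfold Rsqr in H3. lra. }
  assert (H4 := Rmult_le_compat_l v _ _ Hw H2). lra.
Qed.

Lemma p_average_sq u A L' x : bnd u A -> NoDup L' ->
  lsumR (fun y => p x y * Cmod (u y)) L' ^ 2 * m x
    <= lsumR (fun y => Cmod (u y) ^ 2 * m y * p y x) L'.
Proof.
  intros Hu Hn. assert (H := jensen_finite (p x) (fun y => Cmod (u y)) L' (p_nonneg x)).
  assert (H1 := p_sum_le_1 x L' Hn). assert (Hm := mes_pos x).
  set (Q := lsumR (fun y => p x y * Cmod (u y) ^ 2) L') in *.
  assert (HQ : 0 <= Q).
  { apply lsumR_ge_0; intros; apply Rmult_le_pos; [apply p_nonneg|apply pow2_ge_0]. }
  apply Rle_trans with (m x * Q).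
  - rewrite Rmult_comm. apply Rmult_le_compat_l; [lra|]. nra.
  - unfold Q. rewrite <- lsumR_scal. apply lsumR_le; intros y _.
    rewrite <- Rmult_assoc, reversible. apply Req_le; ring.
Qed.

(** Finite form of the contractivity of [P]: after Jensen in each row, reversibility replaces
    [m x p x y] by [m y p y x], and the sum over [x] then contributes a factor at most 1. *)
Lemma p_average_sq_sum u A L L' : bnd u A -> NoDup L -> NoDup L' ->
  lsumR (fun x => lsumR (fun y => p x y * Cmod (u y)) L' ^ 2 * m x) L <= A ^ 2.
Proof.
  intros Hu Hn Hn'.
  apply Rle_trans with (lsumR (fun x => lsumR (fun y => Cmod (u y) ^ 2 * m y * p y x) L') L).
  - apply lsumR_le; intros x _. apply (p_average_sq u A); assumption.
  - rewrite lsumR_swap. apply Rle_trans with (2 := proj2 Hu L' Hn'). apply lsumR_le; intros y _.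
    rewrite lsumR_scal. rewrite <- (Rmult_1_r (Cmod (u y) ^ 2 * m y)) at 2.
    apply Rmult_le_compat_l; [|apply p_sum_le_1, Hn].
    apply Rmult_le_pos; [apply pow2_ge_0|apply Rlt_le, mes_pos].
Qed.

(** The previous bound for the one-point set at [x] is uniform in [L'], which is absolute
    convergence. *)
Lemma bnd_p_summable u A : bnd u A -> p_summable p u.
Proof.
  intros Hu x. exists (A * / sqrt (m x)). intros L' Hn'.
  rewrite (lsumR_ext _ (fun y => p x y * Cmod (u y))).
  - assert (H := p_average_sq_sum u A (x :: nil) L' Hu). simpl in H.
    assert (Hm := mes_pos x). assert (Hs := sqrt_lt_R0 _ Hm).
    assert (E := sqrt_sqrt (m x) (Rlt_le _ _ Hm)).
    apply Rmult_le_reg_r with (sqrt (m x)); [exact Hs|].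
    rewrite Rmult_assoc, Rinv_l, Rmult_1_r by lra.
    apply Rsqr_incr_0_var; [|apply Rlt_le, Hu]. unfold Rsqr.
    set (s := lsumR _ L') in *.
    replace (s * sqrt (m x) * (s * sqrt (m x))) with (s * s * (sqrt (m x) * sqrt (m x))) by ring.
    rewrite E. apply Rle_trans with (A ^ 2); [|apply Req_le; ring].
    apply Rle_trans with (2 := H ltac:(repeat constructor; simpl; tauto) Hn').
    apply Req_le; ring.
  - intros y _. rewrite Cmod_mult, Cmod_R, Rabs_pos_eq by apply p_nonneg. reflexivity.
Qed.

Lemma usum_approx_finite (g : T -> T -> C) L e : 0 < e -> (forall x, abs_summable (g x)) ->
  exists L', NoDup L' /\ forall x, In x L -> Cmod (usum (g x) - lsumC (g x) L') <= e.
Proof.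
  intros He Hg.
  assert (H : exists L0, NoDup L0 /\ forall L', NoDup L' -> incl L0 L' ->
     forall x, In x L -> Cmod (usum (g x) - lsumC (g x) L') <= e).
  { induction L as [|a L [L0 [Hn0 H0]]].
    - exists nil; split; [constructor|]. intros ? _ _ ? [].
    - destruct (usum_approx (g a) e (Hg a) He) as [L1 [Hn1 H1]].
      destruct (NoDup_join L0 L1) as [L2 [Hn2 [Hi0 Hi1]]].
      exists L2; split; [exact Hn2|]. intros L' Hn' Hi' x [<-|Hx].
      + apply Rlt_le, H1; [exact Hn'|]. apply (incl_tran Hi1 Hi').
      + apply H0; [exact Hn'| |exact Hx]. apply (incl_tran Hi0 Hi'). }
  destruct H as [L0 [Hn0 H0]]. exists L0; split; [exact Hn0|]. apply H0; [exact Hn0|apply incl_refl].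
Qed.

(** Truncating the sums to a finite [L'] keeps the bound [A], and on each finite set [P u] is
    approximated by such truncations; lower semicontinuity concludes. *)
Lemma bnd_Pop u A : bnd u A -> bnd (Pop p u) A.
Proof.
  intros Hu. apply bnd_lsc; [apply Hu|]. intros L e He.
  destruct (usum_approx_finite (fun x y => RtoC (p x y) * u y)%C L e He) as [L' [Hn' H]].
  - apply (bnd_p_summable u A Hu).
  - exists (fun x => lsumC (fun y => RtoC (p x y) * u y)%C L'). split; [|exact H].
    split; [apply Hu|]. intros L1 Hn1.
    apply Rle_trans with (2 := p_average_sq_sum u A L1 L' Hu Hn1 Hn').
    apply lsumR_le; intros x _. apply Rmult_le_compat_r; [apply Rlt_le, mes_pos|].
    apply pow_incr; split; [apply Cmod_ge_0|].
    eapply Rle_trans; [apply Cmod_lsumC|]. apply Req_le, lsumR_ext; intros y _.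
    rewrite Cmod_mult, Cmod_R, Rabs_pos_eq by apply p_nonneg. reflexivity.
Qed.

Lemma bnd_Lap mu u A : bnd u A -> bnd (Lap p mu u) ((Cmod mu + 1) * A).
Proof.
  intros Hu. assert (HA := bnd_pos _ _ Hu). assert (Hc := Cmod_ge_0 mu).
  (* The slack [e] covers [mu = 0], where [Cmod mu * A] is not positive and so is no admissible
     bound. *)
  apply bnd_limit; [nra|]. intros e He.
  apply bnd_weaken with ((Cmod mu * A + e) + A); [lra|].
  apply bnd_minus; [|apply bnd_Pop, Hu].
  apply bnd_scal with A; [nra|lra|exact Hu].
Qed.

Lemma complex_cauchy (w : nat -> C) :
  (forall e, 0 < e -> exists N, forall i j, (N <= i)%nat -> (N <= j)%nat -> Cmod (w i - w j) < e) ->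
  exists l, forall e, 0 < e -> exists N, forall i, (N <= i)%nat -> Cmod (w i - l) < e.
Proof.
  intros H.
  assert (HR : forall g : C -> R, (forall a b, g a - g b = g (a - b)%C) ->
     (forall a, Rabs (g a) <= Cmod a) -> exists l : R, is_lim_seq (fun n => g (w n)) l).
  { intros g Hg1 Hg2. apply ex_lim_seq_cauchy_corr. intros e.
    destruct (H e (cond_pos e)) as [N HN]. exists N; intros i j Hi Hj.
    rewrite Hg1. eapply Rle_lt_trans; [apply Hg2|]. apply HN; assumption. }
  destruct (HR Re) as [a Ha]; [intros [? ?] [? ?]; reflexivity|apply re_le_Cmod|].
  destruct (HR Im) as [b Hb]; [intros [? ?] [? ?]; reflexivity| |].
  { intros z; eapply Rle_trans; [apply Rmax_r|apply Rmax_Cmod]. }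
  exists (a, b). intros e He.
  apply is_lim_seq_spec in Ha; apply is_lim_seq_spec in Hb.
  destruct (Ha (mkposreal (e / 4) ltac:(lra))) as [N1 H1].
  destruct (Hb (mkposreal (e / 4) ltac:(lra))) as [N2 H2].
  exists (N1 + N2)%nat; intros i Hi.
  specialize (H1 i ltac:(lia)); specialize (H2 i ltac:(lia)); simpl in H1, H2.
  eapply Rle_lt_trans; [apply Cmod_2Rmax|].
  assert (Hs : sqrt 2 < 2).
  { rewrite <- (sqrt_square 2) at 2 by lra. apply sqrt_lt_1; lra. }
  assert (Hs0 : 0 <= sqrt 2) by apply sqrt_pos.
  assert (Hm : Rmax (Rabs (fst (w i - (a, b))%C)) (Rabs (snd (w i - (a, b))%C)) < e / 4)
    by (apply Rmax_lub_lt; [exact H1|exact H2]).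
  assert (0 <= Rmax (Rabs (fst (w i - (a, b))%C)) (Rabs (snd (w i - (a, b))%C)))
    by (eapply Rle_trans; [apply Rabs_pos|apply Rmax_l]).
  nra.
Qed.

Lemma halving_pow (r : nat -> R) k j : (forall k, 0 < r k /\ r (S k) <= r k / 2) ->
  r (k + j)%nat <= r k * (/ 2) ^ j.
Proof.
  intros H; induction j as [|j IH]; [rewrite Nat.add_0_r; simpl; lra|].
  rewrite Nat.add_succ_r. simpl. generalize (proj2 (H (k + j)%nat)); lra.
Qed.

Lemma halving_small (r : nat -> R) e : 0 < e -> (forall k, 0 < r k /\ r (S k) <= r k / 2) ->
  exists N, r N < e.
Proof.
  intros He H. assert (Hr := proj1 (H 0%nat)).
  destruct (pow_lt_1_zero (/ 2)) with (y := e / r 0%nat) as [N HN].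
  - rewrite Rabs_pos_eq; lra.
  - apply Rdiv_lt_0_compat; assumption.
  - exists N. specialize (HN N (Nat.le_refl N)).
    rewrite Rabs_pos_eq in HN by (apply pow_le; lra).
    eapply Rle_lt_trans; [apply (halving_pow r 0 N H)|].
    apply Rmult_lt_compat_l with (r := r 0%nat) in HN; [|exact Hr].
    replace (r 0%nat * (e / r 0%nat)) with e in HN by (field; lra). exact HN.
Qed.

(** Completeness in the form of nested balls, as both the correction scheme and the Baire argument
    need it: radii at least halve, and increments of at most [r k / 2] keep each ball inside the
    previous one. The pointwise limit inherits the bounds by lower semicontinuity. *)
Lemma bnd_complete (w : nat -> T -> C) (r : nat -> R) :
  (forall k, 0 < r k /\ r (S k) <= r k / 2) ->
  (forall k, bnd (fun x => w (S k) x - w k x)%C (r k / 2)) ->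
  exists v, forall k, bnd (fun x => v x - w k x)%C (r k).
Proof.
  intros Hr Hw.
  assert (Hj : forall j k, bnd (fun x => w (k + j)%nat x - w k x)%C (r k)).
  { induction j as [|j IH]; intros k.
    - apply bnd_ext with (fun _ => 0%C); [intros; rewrite Nat.add_0_r; ring|]. apply bnd_0, Hr.
    - apply bnd_weaken with (r (S k) + r k / 2); [generalize (proj2 (Hr k)); lra|].
      apply bnd_ext with (fun x => (w (S k + j)%nat x - w (S k) x) + (w (S k) x - w k x))%C.
      + intros x. replace (k + S j)%nat with (S k + j)%nat by lia. ring.
      + apply bnd_plus; auto. }
  assert (Hl : forall x, exists l, forall e, 0 < e -> exists N, forall i, (N <= i)%nat ->
            Cmod (w i x - l) < e).
  { intros x. apply (complex_cauchy (fun i => w i x)). intros e He.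
    assert (Hs : 0 < sqrt (m x)) by apply sqrt_lt_R0, mes_pos.
    destruct (halving_small r (e * sqrt (m x) / 2)) as [N HN]; [|exact Hr|].
    { apply Rdiv_lt_0_compat; [apply Rmult_lt_0_compat|]; lra. }
    assert (Hp : forall i, (N <= i)%nat -> Cmod (w i x - w N x) < e / 2).
    { intros i Hi. replace i with (N + (i - N))%nat by lia.
      assert (Hb := bnd_point _ _ x (Hj (i - N)%nat N)). simpl in Hb.
      eapply Rle_lt_trans; [exact Hb|].
      apply Rmult_lt_reg_r with (sqrt (m x)); [exact Hs|].
      rewrite Rmult_assoc, Rinv_l by lra. lra. }
    exists N; intros i j Hi Hj'.
    replace (w i x - w j x)%C with ((w i x - w N x) + - (w j x - w N x))%C by ring.
    eapply Rle_lt_trans; [apply Cmod_triangle|]. rewrite Cmod_opp.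
    generalize (Hp i Hi) (Hp j Hj'); lra. }
  apply choice in Hl. destruct Hl as [v Hv]. exists v; intros k.
  apply bnd_lsc; [apply Hr|]. intros L e He.
  assert (HN : exists N, forall i, (N <= i)%nat -> forall x, In x L -> Cmod (w i x - v x) < e).
  { induction L as [|a L [N1 H1]]; [exists 0%nat; intros ? _ ? []|].
    destruct (Hv a e He) as [N2 H2]. exists (N1 + N2)%nat; intros i Hi x [<-|Hx].
    - apply H2; lia.
    - apply H1; [lia|exact Hx]. }
  destruct HN as [N HN]. exists (fun x => w (k + N)%nat x - w k x)%C. split; [apply Hj|].
  intros x Hx. apply Rlt_le. specialize (HN (k + N)%nat ltac:(lia) x Hx).
  replace (v x - w k x - (w (k + N)%nat x - w k x))%C with (- (w (k + N)%nat x - v x))%C by ring.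
  rewrite Cmod_opp; exact HN.
Qed.

End WeightedSpace.

(** * Bounded inverses of [mu - P], at [lam] and near it *)

Section Resolvent.
Context {T : Type} (adj : T -> T -> Prop) (o : T) (p : T -> T -> R).
Hypothesis (Htree : is_tree adj) (Hst : stochastic adj p).

Local Notation m := (mes adj o p).
Local Notation bnd := (bnd adj o p).
Local Notation Lap := (Lap p).
Local Notation p_summable := (p_summable p).

(** Quantitative membership in the resolvent set: [mu - P] is a bijection of l^2 whose inverse has
    norm at most [M]. The explicit [M] is what makes estimates uniform near [lam]. *)
Definition regular (mu : C) (M : R) : Prop :=
  0 < M /\
  (forall h r, bnd h r -> exists g, bnd g (M * r) /\ forall x, Lap mu g x = h x) /\
  (forall g A, bnd g A -> (forall x, Lap mu g x = 0%C) -> forall x, g x = 0%C).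

Lemma bnd_sub_swap u v A : bnd (fun x => u x - v x)%C A -> bnd (fun x => v x - u x)%C A.
Proof.
  intros H. apply bnd_ext with (fun x => (-1) * (u x - v x))%C; [intros; ring|].
  apply bnd_scal with A; [apply H| |exact H].
  rewrite Cmod_R, Rabs_left; lra.
Qed.

Lemma Lap_minus mu f g x : p_summable f -> p_summable g ->
  Lap mu (fun x => f x - g x)%C x = (Lap mu f x - Lap mu g x)%C.
Proof.
  intros Hf Hg. rewrite (Lap_ext p mu _ (fun x => f x + (-1) * g x)%C) by (intros; ring).
  rewrite Lap_lin by assumption. ring.
Qed.

Lemma regular_unique mu M u v A B : regular mu M -> bnd u A -> bnd v B ->
  (forall x, Lap mu u x = Lap mu v x) -> forall x, u x = v x.
Proof.
  intros [_ [_ Hi]] Hu Hv H x.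
  assert (E : (u x - v x)%C = 0%C).
  { apply (Hi (fun x => u x - v x)%C (A + B)).
    - apply bnd_minus; assumption.
    - intros z. rewrite Lap_minus, H by (eapply bnd_p_summable; eassumption). ring. }
  replace (u x) with (v x + (u x - v x))%C by ring. rewrite E; ring.
Qed.

(** Solve up to an error of half the size, then solve for the residual, and repeat: the corrections
    [K r / 2^k] add up to [2 K r]. This one iteration serves both the open mapping theorem and the
    Neumann series. *)
Lemma solve_of_approx mu K : 0 < K ->
  (forall h r, bnd h r -> exists g, bnd g (K * r) /\ bnd (fun x => h x - Lap mu g x)%C (r / 2)) ->
  forall h r, bnd h r -> exists g, bnd g (2 * K * r) /\ forall x, Lap mu g x = h x.
Proof.
  intros HK Happ h r Hh. assert (Hr := bnd_pos _ _ _ _ _ Hh).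
  assert (HF : forall hr : (T -> C) * R, exists g, bnd (fst hr) (snd hr) ->
     bnd g (K * snd hr) /\ bnd (fun x => fst hr x - Lap mu g x)%C (snd hr / 2)).
  { intros [h' r']; simpl. destruct (excluded_middle_informative (bnd h' r')) as [H|H].
    - destruct (Happ h' r' H) as [g Hg]; exists g; intros; exact Hg.
    - exists h'; intros; contradiction. }
  apply choice in HF. destruct HF as [F HF].
  set (rr := fun k => r * (/ 2) ^ k).
  assert (Hrr : forall k, 0 < rr k) by (intros k; apply Rmult_lt_0_compat; [|apply pow_lt]; lra).
  assert (HrrS : forall k, rr (S k) = rr k / 2) by (intros k; unfold rr; simpl; field).
  set (w := fix w k := match k with
            | O => fun _ : T => RtoC 0
            | S k => fun x => (w k x + F (fun z => h z - Lap mu (w k) z, rr k) x)%C end).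
  assert (Hw : forall k, (exists A, bnd (w k) A) /\ bnd (fun z => h z - Lap mu (w k) z)%C (rr k)).
  { induction k as [|k [[A HA] IH]].
    - split; [exists 1; apply bnd_0; lra|].
      unfold rr; simpl. rewrite Rmult_1_r. apply bnd_ext with (2 := Hh).
      intros x. rewrite (Lap_ext p mu _ (fun x => 0 * h x)%C) by (intros; simpl; ring).
      rewrite Lap_scal by (apply (bnd_p_summable adj o p Htree Hst _ _ Hh)). ring.
    - destruct (HF (fun z => h z - Lap mu (w k) z, rr k)%C IH) as [H1 H2]. simpl in H1, H2.
      split.
      + exists (A + K * rr k). simpl. apply bnd_plus; assumption.
      + rewrite HrrS. apply bnd_ext with (2 := H2). intros x.
        change (w (S k)) with (fun x => w k x + F (fun z => h z - Lap mu (w k) z, rr k) x)%C.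
        rewrite Lap_plus by (eapply bnd_p_summable; eassumption). ring. }
  destruct (bnd_complete adj o p Htree Hst w (fun k => 2 * K * rr k)) as [v Hv].
  - intros k. rewrite HrrS. split; [|apply Req_le; field].
    apply Rmult_lt_0_compat; [lra|apply Hrr].
  - intros k. destruct (HF (fun z => h z - Lap mu (w k) z, rr k)%C (proj2 (Hw k))) as [H1 _]. simpl in H1.
    replace (2 * K * rr k / 2) with (K * rr k) by field.
    apply bnd_ext with (2 := H1). intros x; simpl; ring.
  - assert (Hv0 : bnd v (2 * K * r)).
    { specialize (Hv 0%nat). unfold rr in Hv. simpl in Hv. rewrite Rmult_1_r in Hv.
      apply bnd_ext with (2 := Hv). intros; ring. }
    exists v; split; [exact Hv0|]. intros x.
    assert (E : (Lap mu v x - h x)%C = 0%C).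
    { apply (bnd_small_0 adj o p Htree Hst (fun x => Lap mu v x - h x)%C). intros e He.
      assert (Hc := Cmod_ge_0 mu).
      (* [D * rr k] dominates the bound for [Lap mu (v - w k)] plus the residual of [w k]. *)
      set (D := (Cmod mu + 1) * (2 * K) + 1).
      assert (HD : 0 < D) by (unfold D; nra).
      destruct (halving_small (fun k => D * rr k) e He) as [k Hk].
      { intros k. rewrite HrrS. split; [|apply Req_le; field].
        apply Rmult_lt_0_compat; [exact HD|apply Hrr]. }
      apply bnd_weaken with ((Cmod mu + 1) * (2 * K * rr k) + rr k); [unfold D in Hk; lra|].
      destruct (Hw k) as [[A HA] Hhk].
      apply bnd_ext with (fun x => Lap mu (fun z => v z - w k z)%C x - (h x - Lap mu (w k) x))%C.
      - intros z. rewrite Lap_minus by (eapply bnd_p_summable; eassumption). ring.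
      - apply bnd_minus; [exact Htree|exact Hst| |exact Hhk]. apply bnd_Lap; [exact Htree|exact Hst|apply Hv]. }
    replace (Lap mu v x) with (h x + (Lap mu v x - h x))%C by ring. rewrite E; ring.
Qed.

(* Baire category: the l^2 space is the union of the closures of the images of the balls of
   integer radius, so one of these closures contains a ball. *)
Lemma image_dense_in_ball mu :
  (forall h A, bnd h A -> exists g B, bnd g B /\ forall x, Lap mu g x = h x) ->
  exists h0 r N, 0 < r /\ 0 < N /\ (exists A, bnd h0 A) /\
    forall h, bnd (fun x => h x - h0 x)%C r -> forall e, 0 < e ->
      exists g, bnd g N /\ bnd (fun x => h x - Lap mu g x)%C e.
Proof.
  intros Hsurj. apply Classical_Prop.NNPP; intros Hno.
  (* Negating the claim gives, inside every ball and for every [k], a point at distance more than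
     some [snd he] from the image of the ball of radius [k + 1]. *)
  assert (HF : forall s : nat * ((T -> C) * R), exists he : (T -> C) * R,
     (exists A, bnd (fst (snd s)) A) -> 0 < snd (snd s) ->
     bnd (fun x => fst he x - fst (snd s) x)%C (snd (snd s)) /\ 0 < snd he /\
     forall g, bnd g (INR (fst s) + 1) -> ~ bnd (fun x => fst he x - Lap mu g x)%C (snd he)).
  { intros [k [h0 r]]; simpl. apply Classical_Prop.NNPP; intros H1. apply Hno.
    assert (HA : exists A, bnd h0 A).
    { apply Classical_Prop.NNPP; intros H2. apply H1. exists (h0, r); intros; contradiction. }
    assert (Hr : 0 < r).
    { apply Classical_Prop.NNPP; intros H2. apply H1. exists (h0, r); intros; contradiction. }
    exists h0, r, (INR k + 1). split; [exact Hr|]. split; [generalize (pos_INR k); lra|].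
    split; [exact HA|]. intros h Hh e He.
    apply Classical_Prop.NNPP; intros H2. apply H1. exists (h, e); intros _ _; simpl.
    split; [exact Hh|]. split; [exact He|]. intros g Hg Hg'. apply H2; exists g; tauto. }
  apply choice in HF. destruct HF as [F HF].
  (* Nested balls: half the old radius keeps the new ball inside the old one, the minimum with
     [snd he] keeps it off the image. *)
  set (s := fix s k : (T -> C) * R := match k with
            | O => (fun _ => RtoC 0, 1)
            | S k => let he := F (k, (fst (s k), snd (s k) / 2)) in
                     (fst he, Rmin (snd (s k) / 2) (snd he)) end).
  assert (Hs : forall k, (exists A, bnd (fst (s k)) A) /\ 0 < snd (s k)).
  { induction k as [|k [[A HA] IH]]; [split; [exists 1; apply bnd_0; lra|simpl; lra]|].
    destruct (HF (k, (fst (s k), snd (s k) / 2))) as [H1 [H2 _]]; simpl in *; [eauto|lra|].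
    split; [|apply Rmin_glb_lt; lra].
    exists (snd (s k) / 2 + A). eapply bnd_ext; [|apply (bnd_plus _ _ _ Htree Hst _ _ _ _ H1 HA)].
    intros x; simpl; ring. }
  assert (HFs : forall k, bnd (fun x => fst (s (S k)) x - fst (s k) x)%C (snd (s k) / 2) /\
     forall g, bnd g (INR k + 1) -> ~ bnd (fun x => fst (s (S k)) x - Lap mu g x)%C (snd (s (S k)))).
  { intros k. destruct (Hs k) as [HA Hr].
    destruct (HF (k, (fst (s k), snd (s k) / 2))) as [H1 [H2 H3]]; [exact HA|simpl; lra|].
    split; [exact H1|]. intros g Hg Hb. apply (H3 g Hg).
    apply bnd_weaken with (2 := Hb). apply Rmin_r. }
  destruct (bnd_complete adj o p Htree Hst (fun k => fst (s k)) (fun k => snd (s k))) as [v Hv].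
  - intros k. split; [apply Hs|]. apply Rmin_l.
  - intros k; apply HFs.
  - assert (Hv0 : bnd v 1).
    { specialize (Hv 0%nat). simpl in Hv. apply bnd_ext with (2 := Hv). intros; ring. }
    destruct (Hsurj v 1 Hv0) as [g [B [Hg HgB]]].
    (* The limit [v] has a preimage of norm at most [B], which contradicts the choice made at a
       stage [k > B]. *)
    destruct (INR_unbounded B) as [k Hk].
    apply (proj2 (HFs k) g).
    + apply bnd_weaken with B; [lra|exact Hg].
    + apply bnd_sub_swap. apply bnd_ext with (2 := Hv (S k)). intros x; rewrite HgB; reflexivity.
Qed.

(** Open mapping theorem for [mu - P]. Subtracting approximate preimages of [h0] and of [h0] plus
    the rescaled [h] moves the ball to the origin; two errors [r / 4], scaled back by [s / r], give
    the residual [s / 2] required by [solve_of_approx]. *)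
Lemma bounded_inverse mu :
  (forall h A, bnd h A -> exists g B, bnd g B /\ forall x, Lap mu g x = h x) ->
  exists K, 0 < K /\
    forall h r, bnd h r -> exists g, bnd g (K * r) /\ forall x, Lap mu g x = h x.
Proof.
  intros Hsurj. destruct (image_dense_in_ball mu Hsurj) as [h0 [r [N [Hr [HN [[A HA] H]]]]]].
  assert (HK : 0 < 2 * N / r) by (apply Rdiv_lt_0_compat; lra).
  exists (2 * (2 * N / r)). split; [lra|]. apply solve_of_approx; [exact HK|].
  intros h s Hh. assert (Hs := bnd_pos _ _ _ _ _ Hh).
  assert (Hrs : 0 < r / s) by (apply Rdiv_lt_0_compat; assumption).
  assert (Hsr : 0 < s / r) by (apply Rdiv_lt_0_compat; assumption).
  destruct (H (fun x => h0 x + RtoC (r / s) * h x)%C) with (e := r / 4) as [g1 [H1 H1']]; [|lra|].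
  { apply bnd_ext with (fun x => RtoC (r / s) * h x)%C; [intros; ring|].
    apply bnd_scal with s; [exact Hr| |exact Hh].
    rewrite Cmod_R, Rabs_pos_eq by lra. apply Req_le; field; lra. }
  destruct (H h0) with (e := r / 4) as [g2 [H2 H2']]; [|lra|].
  { apply bnd_ext with (fun _ => RtoC 0); [intros; ring|]. apply bnd_0, Hr. }
  assert (S1 := bnd_p_summable adj o p Htree Hst _ _ H1).
  assert (S2 := bnd_p_summable adj o p Htree Hst _ _ H2).
  exists (fun x => RtoC (s / r) * (g1 x - g2 x))%C. split.
  - apply bnd_scal with (N + N); [nra| |apply bnd_minus; assumption].
    rewrite Cmod_R, Rabs_pos_eq by lra. apply Req_le; field; lra.
  - apply bnd_ext with (fun x => RtoC (s / r) *
      ((h0 x + RtoC (r / s) * h x - Lap mu g1 x) - (h0 x - Lap mu g2 x)))%C.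
    + intros x. rewrite Lap_scal, Lap_minus; [|exact S1|exact S2|].
      * replace (h x) with (RtoC (s / r) * (RtoC (r / s) * h x))%C at 2; [ring|].
        rewrite Cmult_assoc, <- RtoC_mult. replace (s / r * (r / s)) with 1 by (field; lra). ring.
      * apply (bnd_p_summable adj o p Htree Hst _ (N + N)). apply bnd_minus; assumption.
    + apply bnd_scal with (r / 4 + r / 4); [lra| |apply bnd_minus; assumption].
      rewrite Cmod_R, Rabs_pos_eq by lra. apply Req_le; field; lra.
Qed.

(** [in_res] provides surjectivity, to which [bounded_inverse] applies, and uniqueness for the
    right-hand side 0, which is injectivity. *)
Lemma in_res_regular lam : in_res adj o p lam -> exists M, regular lam M.
Proof.
  intros Hres. destruct (bounded_inverse lam) as [K [HK H]].
  - intros h A Hh. destruct (Hres h) as [g [[Hg1 Hg2] _]]; [apply l2_bnd; eauto|].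
    apply l2_bnd in Hg1; [|exact Htree|exact Hst]. destruct Hg1 as [B HB].
    exists g, B; split; [exact HB|exact Hg2].
  - exists K; split; [exact HK|]. split; [exact H|]. intros g A Hg H0 x.
    destruct (Hres (fun _ => RtoC 0)) as [g0 [_ Hu]].
    { apply l2_bnd; [exact Htree|exact Hst|]. exists 1; apply bnd_0; lra. }
    assert (E : (fun _ : T => RtoC 0) = g).
    { transitivity g0; [symmetry|]; apply Hu.
      - split; [apply l2_bnd; [exact Htree|exact Hst|exists 1; apply bnd_0; lra]|].
        intros z. change (Lap lam (fun _ => RtoC 0) z = 0%C).
        rewrite (Lap_ext p lam _ (fun x => 0 * g x)%C) by (intros; ring).
        rewrite Lap_scal by (apply (bnd_p_summable adj o p Htree Hst _ _ Hg)). ring.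
      - split; [apply l2_bnd; eauto|]. exact H0. }
    rewrite <- E; reflexivity.
Qed.

(** A solution at [lam] is an approximate solution at [mu], with residual at most half the size. For
    injectivity, [(mu - P) g = 0] means [(lam - P) g = - (mu - lam) g], so any bound for [g] can be
    halved indefinitely. *)
Lemma regular_near lam mu M :
  regular lam M -> Cmod (mu - lam) * M <= 1 / 2 -> regular mu (2 * M).
Proof.
  intros Hreg Hmu. assert (Hreg' := Hreg). destruct Hreg' as [HM [Hs Hi]].
  split; [lra|]. split.
  - intros h r Hh. apply solve_of_approx; [exact HM| |exact Hh]. clear h r Hh.
    intros h r Hh. destruct (Hs h r Hh) as [g [Hg HgE]]. exists g; split; [exact Hg|].
    assert (Hr := bnd_pos _ _ _ _ _ Hh).
    apply bnd_ext with (fun x => (- (mu - lam)) * g x)%C.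
    + intros x. rewrite (Lap_shift p mu lam), HgE. ring.
    + apply bnd_scal with (M * r); [lra| |exact Hg].
      rewrite Cmod_opp. rewrite <- Rmult_assoc. nra.
  - intros g A Hg H0.
    assert (Hhalf : forall B, bnd g B -> bnd g (B / 2)).
    { intros B HB. assert (HB0 := bnd_pos _ _ _ _ _ HB).
      assert (Hb : bnd (fun x => (- (mu - lam)) * g x)%C (B / 2 / M)).
      { apply bnd_scal with B; [ | |exact HB].
        - apply Rdiv_lt_0_compat; lra.
        - rewrite Cmod_opp. apply Rmult_le_reg_r with M; [exact HM|].
          replace (B / 2 / M * M) with (B / 2) by (field; lra). nra. }
      destruct (Hs _ _ Hb) as [g' [Hg' HE]].
      replace (M * (B / 2 / M)) with (B / 2) in Hg' by (field; lra).
      apply bnd_ext with (2 := Hg').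
      apply (regular_unique lam M _ _ _ _ Hreg Hg' HB).
      intros x. rewrite HE. assert (E := H0 x). rewrite (Lap_shift p mu lam) in E.
      replace (Lap lam g x) with ((Lap lam g x + (mu - lam) * g x) + - (mu - lam) * g x)%C by ring.
      rewrite E; ring. }
    intros x. apply (bnd_small_0 adj o p Htree Hst). intros e He.
    assert (HA := bnd_pos _ _ _ _ _ Hg).
    destruct (halving_small (fun k => A * (/ 2) ^ k) e He) as [k Hk].
    { intros k; split; [apply Rmult_lt_0_compat; [|apply pow_lt]; lra|simpl; lra]. }
    apply bnd_weaken with (A * (/ 2) ^ k); [lra|].
    clear Hk. induction k as [|k IH]; [simpl; rewrite Rmult_1_r; exact Hg|].
    replace (A * (/ 2) ^ S k) with (A * (/ 2) ^ k / 2) by (simpl; field). apply Hhalf, IH.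
Qed.

Local Notation G := (Green adj o p).

(** Regularity supplies a witness, so the choice in [Green] is genuine; uniqueness transfers the
    bound of the witness to it. *)
Lemma Green_spec mu M v : regular mu M ->
  bnd (fun x => G mu x v) (M * sqrt (m v)) /\ forall z, Lap mu (fun x => G mu x v) z = indicator v z.
Proof.
  intros Hreg. assert (Hreg' := Hreg). destruct Hreg' as [HM [Hs Hi]].
  destruct (Hs _ _ (bnd_indicator adj o p Htree Hst v)) as [g [Hg HE]].
  assert (Hex : exists g, l2 adj o p g /\ forall z, (mu * g z - Pop p g z)%C = indicator v z).
  { exists g; split; [apply l2_bnd; eauto|exact HE]. }
  assert (Hp := epsilon_spec (inhabits (fun _ : T => RtoC 0)) _ Hex).
  change (epsilon (inhabits (fun _ : T => RtoC 0))
    (fun g => l2 adj o p g /\ forall z, (mu * g z - Pop p g z)%C = indicator v z))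
    with (fun x => G mu x v) in Hp.
  destruct Hp as [H1 H2]. split; [|exact H2].
  apply l2_bnd in H1; [|exact Htree|exact Hst]. destruct H1 as [B HB].
  apply bnd_ext with (2 := Hg). apply (regular_unique mu M _ _ _ _ Hreg Hg HB).
  intros z; rewrite HE. symmetry; apply H2.
Qed.

End Resolvent.

(** * Product formulas for the Green function along edges *)

Section GreenOnTree.
Context {T : Type} (adj : T -> T -> Prop) (o : T) (p : T -> T -> R).
Hypothesis (Htree : is_tree adj) (Hst : stochastic adj p).

Local Notation m := (mes adj o p).
Local Notation bnd := (bnd adj o p).
Local Notation geo := (geo adj o).
Local Notation is_child := (is_child adj o).
Local Notation regular := (regular adj o p).

Lemma bnd_restrict (Q : T -> Prop) u A :
  bnd u A -> bnd (fun z => if decide (Q z) then u z else 0%C) A.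
Proof.
  intros [HA Hu]; split; [exact HA|]. intros L Hn.
  apply Rle_trans with (2 := Hu L Hn). apply lsumR_le; intros x _.
  assert (Hm := mes_pos adj o p Htree Hst x).
  case_decide; [lra|]. rewrite Cmod_0. generalize (pow2_ge_0 (Cmod (u x))); nra.
Qed.

Section FixedParameter.
Context (mu : C) (M : R).
Hypothesis (Hreg : regular mu M).

Local Notation G := (Green adj o p mu).
Local Open Scope C_scope.

Lemma Green_p_summable v : p_summable p (fun x => G x v).
Proof. eapply bnd_p_summable; [exact Htree|exact Hst|]. apply (Green_spec adj o p Htree Hst mu M v Hreg). Qed.

Lemma Lap_Green v z : Lap p mu (fun x => G x v) z = indicator v z.
Proof. apply (Green_spec adj o p Htree Hst mu M v Hreg). Qed.

(* [u] vanishes at [x], so cutting it off outside the branch at [y] creates a defect at [x]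
   only; both sides are l^2 solutions of the same equation. *)
Lemma Green_branch x y v : is_child y x ->
  let u z := G x x * G z v - G x v * G z x in
  forall z, (if decide (In y (geo z)) then u z else 0)
    = (if decide (In y (geo v)) then G x x else 0) * G z v - RtoC (p x y) * u y * G z x.
Proof.
  intros Hc u. assert (Hux : u x = 0) by (unfold u; ring).
  assert (HyB : In y (geo y)) by (apply (In_geo_self adj o Htree)).
  assert (HxB : ~ In y (geo x)) by (apply (child_not_In adj o Htree _ _ Hc)).
  (* Sources of the truncated [u]: [G x x] at [v] if [v] lies in the branch, and [- p x y * u y] at
     [x]. The source of [u] at [x] itself is cut away. *)
  set (c := if decide (In y (geo v)) then G x x else 0).
  destruct (Green_spec adj o p Htree Hst mu M v Hreg) as [Bv _].
  destruct (Green_spec adj o p Htree Hst mu M x Hreg) as [Bx _].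
  assert (Hlin : forall a b, exists A, bnd (fun z => a * G z v + b * G z x) A).
  { intros a b. eexists. apply bnd_plus; [exact Htree|exact Hst| |].
    - eapply bnd_scal with (B := (Cmod a * (M * sqrt (m v)) + 1)%R); [| |exact Bv]; [|lra].
      generalize (Cmod_ge_0 a) (bnd_pos _ _ _ _ _ Bv); nra.
    - eapply bnd_scal with (B := (Cmod b * (M * sqrt (m x)) + 1)%R); [| |exact Bx]; [|lra].
      generalize (Cmod_ge_0 b) (bnd_pos _ _ _ _ _ Bx); nra. }
  assert (HLap : forall a b z, Lap p mu (fun z => a * G z v + b * G z x) z
     = a * indicator v z + b * indicator x z).
  { intros a b z. rewrite Lap_plus, !Lap_scal, !Lap_Green; auto using p_summable_scal, Green_p_summable. }
  destruct (Hlin (G x x) (- G x v)) as [A HA].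
  assert (Hu : bnd u A) by (apply bnd_ext with (2 := HA); intros; unfold u; ring).
  destruct (Hlin c (- (RtoC (p x y) * u y))) as [B HB].
  intros z0.
  rewrite (regular_unique adj o p Htree Hst mu M _ _ _ _ Hreg (bnd_restrict (fun z => In y (geo z)) u A Hu) HB);
    [ring|].
  clear z0. intros z. rewrite HLap.
  destruct (excluded_middle_informative (In y (geo z))) as [HzB|HzB].
  - transitivity (Lap p mu u z).
    + unfold Lap. rewrite (decide_true _ HzB). apply (f_equal (fun s => mu * u z - s)).
      apply usum_ext; intros w. case_decide; [reflexivity|].
      destruct (excluded_middle_informative (adj z w)) as [Hzw|Hzw].
      * destruct (branch_cross adj o Htree _ _ _ _ Hc Hzw HzB Hd) as [_ ->]. rewrite Hux; reflexivity.
      * rewrite (p_nonadj adj p Hst _ _ Hzw). ring.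
    + rewrite (Lap_ext p mu u (fun z => G x x * G z v + (- G x v) * G z x))
        by (intros; unfold u; ring).
      rewrite HLap. unfold indicator.
      rewrite (decide_false (z = x)) by (intros ->; contradiction).
      case_decide; [|ring]. subst z. unfold c. rewrite (decide_true _ HzB). ring.
  - transitivity (- (RtoC (p z y) * u y)).
    + unfold Lap, Pop. rewrite (decide_false _ HzB).
      rewrite (usum_single y), (decide_true _ HyB); [ring|].
      intros w Hw. case_decide; [|ring].
      destruct (excluded_middle_informative (adj w z)) as [Hwz|Hwz].
      * destruct (branch_cross adj o Htree _ _ _ _ Hc Hwz Hd HzB) as [E _]. contradiction.
      * rewrite (p_nonadj adj p Hst z w); [ring|]. intros H; apply Hwz, Htree, H.
    + unfold indicator. destruct (excluded_middle_informative (z = x)) as [->|Hzx].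
      * rewrite (decide_true (x = x)) by reflexivity. unfold c.
        case_decide; [rewrite decide_false; [ring|]; intros ->; contradiction|ring].
      * rewrite (decide_false (z = x)) by exact Hzx.
        rewrite (p_nonadj adj p Hst z y).
        -- unfold c. case_decide; [rewrite decide_false; [ring|]; intros ->; contradiction|ring].
        -- intros H. apply Hzx.
           destruct (branch_cross adj o Htree y x y z Hc) as [_ E]; auto. apply Htree, H.
Qed.

(** [Green_branch] with [v = y] at [z = x], where the left side is 0, divided by [G x x]. *)
Lemma Green_edge x y : is_child y x -> G x x <> 0 ->
  RtoC (p x y) * (G x x * G y y - G x y * G y x) = G x y.
Proof.
  intros Hc Hx. assert (H := Green_branch x y y Hc x). cbv zeta in H.
  rewrite (decide_false _ (child_not_In adj o Htree _ _ Hc)) in H.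
  rewrite (decide_true _ (In_geo_self adj o Htree y)) in H.
  set (a := RtoC (p x y) * (G x x * G y y - G x y * G y x)) in *.
  assert (E : G x x * (G x y - a) = 0) by (rewrite H; ring).
  apply Cmult_eq_0 in E. destruct E as [E|E]; [contradiction|].
  replace a with (G x y - (G x y - a)) by ring. rewrite E; ring.
Qed.

(** [Green_branch] with [v = y] at a point [z] outside the branch; [Green_edge] identifies
    [p x y * u y] with [G x y]. It expresses that the path from [z] to [y] passes through [x]. *)
Lemma Green_factor_below x y z : is_child y x -> G x x <> 0 -> ~ In y (geo z) ->
  G x x * G z y = G x y * G z x.
Proof.
  intros Hc Hx Hz. assert (H := Green_branch x y y Hc z). cbv zeta in H.
  rewrite (decide_false _ Hz), (decide_true _ (In_geo_self adj o Htree y)) in H.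
  rewrite (Green_edge x y Hc Hx) in H.
  replace (G x x * G z y) with (G x y * G z x + (G x x * G z y - G x y * G z x)) by ring.
  rewrite <- H; ring.
Qed.

(** With [v] outside the branch, [Green_branch] at [z = x] leaves [p x y * u y * G x x = 0], hence
    [u y = 0]. *)
Lemma Green_factor_above x y v : is_child y x -> G x x <> 0 -> ~ In y (geo v) ->
  G x x * G y v = G x v * G y x.
Proof.
  intros Hc Hx Hv. assert (H := Green_branch x y v Hc x). cbv zeta in H.
  rewrite (decide_false _ Hv), (decide_false _ (child_not_In adj o Htree _ _ Hc)) in H.
  assert (Hp := p_pos adj p Hst _ _ (child_adj adj o Htree _ _ Hc)).
  assert (E : RtoC (p x y) * G x x * (G x x * G y v - G x v * G y x) = 0).
  { transitivity (- RtoC 0); [rewrite H|]; ring. }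
  apply Cmult_eq_0 in E. destruct E as [E|E].
  - apply Cmult_eq_0 in E. destruct E as [E|E]; [|contradiction].
    apply RtoC_inj in E. lra.
  - replace (G x x * G y v) with (G x v * G y x + (G x x * G y v - G x v * G y x)) by ring.
    rewrite E; ring.
Qed.

Lemma not_In_geo_o y x : is_child y x -> ~ In y (geo o).
Proof. intros [Hy _]. rewrite geo_o by exact Htree. intros [H|[]]; congruence. Qed.

(** If [G o y] vanished, factorisation through the parent [x] would force [G x y = 0], and then
    [Green_edge] would force [G x x * G y y = 0]. Thus a nonzero diagonal makes the denominators of
    all kernels nonzero. *)
Lemma Green_o_nonzero : (forall x, G x x <> 0) -> forall v, G o v <> 0.
Proof.
  intros H v. induction v as [|x y Hc IH] using (tree_ind adj o Htree); [apply H|].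
  intros E.
  assert (E1 := Green_factor_below x y o Hc (H x) (not_In_geo_o _ _ Hc)).
  rewrite E in E1. assert (E2 : G x y * G o x = 0) by (rewrite <- E1; ring).
  apply Cmult_eq_0 in E2. destruct E2 as [E2|E2]; [|contradiction].
  assert (E3 := Green_edge x y Hc (H x)). rewrite E2 in E3.
  assert (E4 : RtoC (p x y) * (G x x * G y y) = 0) by (rewrite <- E3; ring).
  apply Cmult_eq_0 in E4. destruct E4 as [E4|E4].
  - apply RtoC_inj in E4. assert (Hp := p_pos adj p Hst _ _ (child_adj adj o Htree _ _ Hc)). lra.
  - apply Cmult_eq_0 in E4. destruct E4; eapply H; eassumption.
Qed.

Lemma kernel_edge x y : is_child y x -> G x x <> 0 -> G o x <> 0 -> G o y <> 0 ->
  RtoC (p x y) * (G y y / G o y - G y x / G o x) = / G o x.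
Proof.
  intros Hc Hx Hox Hoy.
  assert (E1 := Green_factor_below x y o Hc Hx (not_In_geo_o _ _ Hc)).
  assert (E2 := Green_edge x y Hc Hx).
  assert (Hxy : G x y <> 0).
  { intros E. rewrite E in E1. assert (E3 : G x x * G o y = 0) by (rewrite E1; ring).
    apply Cmult_eq_0 in E3; tauto. }
  assert (E3 : G o y = G x y * G o x / G x x) by (rewrite <- E1; field; exact Hx).
  rewrite E3. transitivity (RtoC (p x y) * (G x x * G y y - G x y * G y x) / (G x y * G o x)).
  - field. auto.
  - rewrite E2. field. auto.
Qed.

Lemma kernel_parent x y : is_child y x -> G x x <> 0 -> G o x <> 0 -> G o y <> 0 ->
  G x y / G o y = G x x / G o x.
Proof.
  intros Hc Hx Hox Hoy.
  assert (E1 := Green_factor_below x y o Hc Hx (not_In_geo_o _ _ Hc)).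
  replace (G x y / G o y) with (G x y * G o x / (G o x * G o y)) by (field; auto).
  rewrite <- E1. field; auto.
Qed.

(** The factor [G y x / G x x] is the same for all [v] on the path to [x], so the whole part of an
    integral carried by that path scales by it. *)
Lemma kernel_child x y v : is_child y x -> G x x <> 0 -> G o v <> 0 -> In v (geo x) ->
  G y v / G o v = G y x / G x x * (G x v / G o v).
Proof.
  intros Hc Hx Hov Hv.
  assert (Hy : ~ In y (geo v)).
  { intros H. apply (child_not_In adj o Htree _ _ Hc). apply (In_geo_trans adj o Htree _ _ _ H Hv). }
  assert (E := Green_factor_above x y v Hc Hx Hy).
  replace (G y v / G o v) with (G x x * G y v / (G x x * G o v)) by (field; auto).
  rewrite E. field; auto.
Qed.

End FixedParameter.
End GreenOnTree.

(** * Complex derivatives of all orders on a disc *)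

Section ComplexDerivatives.

(** Differentiability with an explicit remainder: it implies [is_derive] over [C] and can be fed
    directly by norm estimates. *)
Definition has_deriv (f : C -> C) (z l : C) : Prop :=
  forall e, 0 < e -> exists d, 0 < d /\ forall w, Cmod (w - z) < d ->
    Cmod (f w - f z - (w - z) * l) <= e * Cmod (w - z).

Lemma has_deriv_is_derive f z l : has_deriv f z l -> is_derive f z l.
Proof.
  intros H. split; [apply is_linear_scal_l|]. intros x Hx.
  apply (@is_filter_lim_locally_unique C_AbsRing (AbsRing_NormedModule C_AbsRing)) in Hx.
  rewrite <- Hx. intros e.
  destruct (H e (cond_pos e)) as [d [Hd Hw]].
  exists (mkposreal d Hd). intros w Hball.
  change (Cmod (w - z) < d) in Hball. specialize (Hw w Hball).
  exact Hw.
Qed.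

Lemma CDerive_eq f z l : has_deriv f z l -> CDerive f z = l.
Proof.
  intros H; apply has_deriv_is_derive in H.
  rewrite <- (is_C_derive_unique f z l H).
  symmetry; apply is_C_derive_unique. unfold CDerive.
  apply (epsilon_spec (inhabits (RtoC 0)) (fun l => is_derive f z l)). exists l; exact H.
Qed.

Lemma has_deriv_local f g z l d : 0 < d ->
  (forall w, Cmod (w - z) < d -> f w = g w) -> has_deriv f z l -> has_deriv g z l.
Proof.
  intros Hd E H e He. destruct (H e He) as [d' [Hd' Hw]].
  exists (Rmin d d'); split; [apply Rmin_glb_lt; assumption|]. intros w Hwz.
  rewrite <- !E.
  - apply Hw. eapply Rlt_le_trans; [exact Hwz|apply Rmin_r].
  - replace (z - z)%C with (RtoC 0) by ring. rewrite Cmod_0; exact Hd.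
  - eapply Rlt_le_trans; [exact Hwz|apply Rmin_l].
Qed.

Lemma has_deriv_minus f g z l k :
  has_deriv f z l -> has_deriv g z k -> has_deriv (fun w => f w - g w)%C z (l - k)%C.
Proof.
  intros Hf Hg e He. destruct (Hf (e / 2)) as [d1 [Hd1 H1]]; [lra|].
  destruct (Hg (e / 2)) as [d2 [Hd2 H2]]; [lra|].
  exists (Rmin d1 d2); split; [apply Rmin_glb_lt; assumption|]. intros w Hw.
  specialize (H1 w (Rlt_le_trans _ _ _ Hw (Rmin_l _ _))).
  specialize (H2 w (Rlt_le_trans _ _ _ Hw (Rmin_r _ _))).
  replace (f w - g w - (f z - g z) - (w - z) * (l - k))%C
    with ((f w - f z - (w - z) * l) + - (g w - g z - (w - z) * k))%C by ring.
  eapply Rle_trans; [apply Cmod_triangle|]. rewrite Cmod_opp. lra.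
Qed.

Lemma has_deriv_scal c f z l : has_deriv f z l -> has_deriv (fun w => c * f w)%C z (c * l)%C.
Proof.
  intros H e He. assert (Hc := Cmod_ge_0 c).
  destruct (H (e / (Cmod c + 1))) as [d [Hd Hw]]; [apply Rdiv_lt_0_compat; lra|].
  exists d; split; [exact Hd|]. intros w Hwz. specialize (Hw w Hwz).
  replace (c * f w - c * f z - (w - z) * (c * l))%C with (c * (f w - f z - (w - z) * l))%C by ring.
  rewrite Cmod_mult.
  apply Rle_trans with ((Cmod c + 1) * Cmod (f w - f z - (w - z) * l)).
  - generalize (Cmod_ge_0 (f w - f z - (w - z) * l)); nra.
  - apply Rle_trans with ((Cmod c + 1) * (e / (Cmod c + 1) * Cmod (w - z))).
    + apply Rmult_le_compat_l; lra.
    + apply Req_le; field; lra.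
Qed.

(** Candidates for the successive derivatives on a whole disc. To identify an iterated [CDerive] at
    a point, the lower derivatives must be known in a neighbourhood of it. *)
Definition deriv_chain (z : C) (d : R) (a : nat -> C -> C) : Prop :=
  forall r w, Cmod (w - z) < d -> has_deriv (a r) w (a (S r) w).

Lemma CDerive_n_chain z d a f : deriv_chain z d a ->
  (forall w, Cmod (w - z) < d -> f w = a 0%nat w) ->
  forall r w, Cmod (w - z) < d -> CDerive_n r f w = a r w.
Proof.
  intros Ha H0 r; induction r as [|r IH]; intros w Hw; [apply H0, Hw|].
  simpl. apply CDerive_eq. apply has_deriv_local with (f := a r) (d := d - Cmod (w - z)).
  - lra.
  - intros w' Hw'. symmetry; apply IH.
    replace (w' - z)%C with ((w' - w) + (w - z))%C by ring.
    eapply Rle_lt_trans; [apply Cmod_triangle|lra].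
  - apply Ha, Hw.
Qed.

Lemma deriv_chain_shrink z d d' a : d' <= d -> deriv_chain z d a -> deriv_chain z d' a.
Proof. intros Hd H r w Hw; apply H; lra. Qed.

Lemma deriv_chain_diff z d c a b : deriv_chain z d a -> deriv_chain z d b ->
  deriv_chain z d (fun r w => c * (a r w - b r w))%C.
Proof. intros Ha Hb r w Hw. apply has_deriv_scal, has_deriv_minus; auto. Qed.

End ComplexDerivatives.

(** * Continuity of the Green function in [mu], and the problem pinned at the root *)

Section KernelDerivatives.
Context {T : Type} (adj : T -> T -> Prop) (o : T) (p : T -> T -> R).
Hypothesis (Htree : is_tree adj) (Hst : stochastic adj p).

Local Notation m := (mes adj o p).
Local Notation bnd := (bnd adj o p).
Local Notation G := (Green adj o p).
Local Notation regular := (regular adj o p).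
Local Notation Lap := (Lap p).

(** Resolvent identity: the difference solves [(mu - P) g = - (mu - lam) G(., b | lam)], with an
    inverse bounded by [2 M] near [lam]. *)
Lemma Green_continuous lam M a b : regular lam M ->
  forall e, 0 < e -> exists d, 0 < d /\ forall mu, Cmod (mu - lam) < d ->
    Cmod (G mu a b - G lam a b) < e.
Proof.
  intros Hreg e He. assert (HM : 0 < M) by apply Hreg.
  destruct (Green_spec adj o p Htree Hst lam M b Hreg) as [HG HE].
  set (X := M * sqrt (m b)) in *. assert (HX : 0 < X) by apply (bnd_pos _ _ _ _ _ HG).
  assert (Hs : 0 < sqrt (m a)) by apply sqrt_lt_R0, (mes_pos adj o p Htree Hst).
  set (Q := 2 * M * X * / sqrt (m a)).
  assert (HQ : 0 < Q).
  { unfold Q. apply Rmult_lt_0_compat; [|apply Rinv_0_lt_compat, Hs].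
    apply Rmult_lt_0_compat; lra. }
  (* The first entry keeps [mu] in the range of [regular_near]. The second makes the error at most
     [d * Q <= e / 2], where [Q] combines the inverse bound [2 M], the norm bound [X] of the Green
     function and the cost of evaluation at [a]. *)
  set (d := Rmin (/ (2 * M)) (e / 2 / Q)).
  assert (Hd : 0 < d).
  { apply Rmin_glb_lt; [apply Rinv_0_lt_compat; lra|]. apply Rdiv_lt_0_compat; lra. }
  exists d; split; [exact Hd|]. intros mu Hmu.
  assert (Hregmu : regular mu (2 * M)).
  { apply (regular_near adj o p Htree Hst lam); [exact Hreg|].
    apply Rle_trans with (/ (2 * M) * M); [|apply Req_le; field; lra].
    apply Rmult_le_compat_r; [lra|]. apply Rlt_le, (Rlt_le_trans _ _ _ Hmu), Rmin_l. }
  destruct (Green_spec adj o p Htree Hst mu _ b Hregmu) as [HG' HE'].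
  assert (Hsol := proj1 (proj2 Hregmu)).
  assert (Hh : bnd (fun x => (- (mu - lam)) * G lam x b)%C (d * X)).
  { apply bnd_scal with X; [nra| |exact HG]. rewrite Cmod_opp. nra. }
  destruct (Hsol _ _ Hh) as [g [Hg HgE]].
  assert (E : (G mu a b - G lam a b)%C = g a).
  { apply (regular_unique adj o p Htree Hst mu _ (fun x => G mu x b - G lam x b)%C g _ _ Hregmu
       (bnd_minus _ _ _ Htree Hst _ _ _ _ HG' HG) Hg).
    intros x. rewrite HgE, Lap_minus by (eapply bnd_p_summable; eassumption).
    rewrite HE', (Lap_shift p mu lam), HE. ring. }
  rewrite E. eapply Rle_lt_trans; [apply (bnd_point adj o p Htree Hst _ _ a Hg)|].
  apply Rle_lt_trans with (d * Q); [apply Req_le; unfold Q; ring|].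
  apply Rle_lt_trans with (e / 2 / Q * Q); [apply Rmult_le_compat_r; [lra|apply Rmin_r]|].
  replace (e / 2 / Q * Q) with (e / 2) by (field; lra). lra.
Qed.

Lemma Green_near_nonzero lam M a b : regular lam M -> G lam a b <> 0%C ->
  exists d, 0 < d /\ forall mu, Cmod (mu - lam) < d -> Cmod (G lam a b) / 2 <= Cmod (G mu a b).
Proof.
  intros Hreg H0. apply Cmod_gt_0 in H0.
  destruct (Green_continuous lam M a b Hreg (Cmod (G lam a b) / 2)) as [d [Hd H]]; [lra|].
  exists d; split; [exact Hd|]. intros mu Hmu. specialize (H mu Hmu).
  assert (Cmod (G lam a b) <= Cmod (G mu a b) + Cmod (G mu a b - G lam a b)); [|lra].
  replace (G lam a b) with (G mu a b + - (G mu a b - G lam a b))%C at 1 by ring.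
  rewrite <- (Cmod_opp (G mu a b - G lam a b)). apply Cmod_triangle.
Qed.

(* [mu] is regular for the problem of solving [(mu - P) q = h + c 1_v] with [q o = 0],
   the unknowns being the function [q] and the scalar [c]. *)
Definition pinned_regular (v : T) (mu : C) (K : R) : Prop :=
  0 < K /\
  (forall h r, bnd h r -> exists q c, bnd q (K * r) /\ q o = 0%C /\
     forall z, Lap mu q z = (h z + c * indicator v z)%C) /\
  (forall q h c r A, bnd q A -> q o = 0%C -> bnd h r ->
     (forall z, Lap mu q z = (h z + c * indicator v z)%C) ->
     bnd q (K * r) /\ Cmod c <= K * r).

(** Solve [(mu - P) g = h] and add [c G(., v)] with [c = - g o / G mu o v] to enforce the value 0 at
    [o]. The constant is a bound [K1] for [q] plus a bound [K2] for [c], the latter read off the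
    equation at [v]. Two solutions differ by a multiple of [G(., v)], which is 0 because [G mu o v]
    is not. Only [M], [R0] and [eta] enter the constant, so it can serve a whole disc of [mu]. *)
Lemma pinned_regular_of_regular v mu M eta R0 : regular mu M -> Cmod mu <= R0 ->
  0 < eta -> eta <= Cmod (G mu o v) ->
  pinned_regular v mu (M + M * / sqrt (m o) * / eta * (M * sqrt (m v))
     + ((R0 + 1) * (M + M * / sqrt (m o) * / eta * (M * sqrt (m v))) + 1) * / sqrt (m v)).
Proof.
  intros Hreg HR Heta HGo. assert (Hreg' := Hreg). destruct Hreg' as [HM [Hsol _]].
  assert (Hsv : 0 < sqrt (m v)) by apply sqrt_lt_R0, (mes_pos adj o p Htree Hst).
  assert (Hso : 0 < sqrt (m o)) by apply sqrt_lt_R0, (mes_pos adj o p Htree Hst).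
  assert (Hiv := Rinv_0_lt_compat _ Hsv). assert (Hio := Rinv_0_lt_compat _ Hso).
  assert (Hie := Rinv_0_lt_compat _ Heta).
  assert (HR0 : 0 <= R0) by (generalize (Cmod_ge_0 mu); lra).
  set (D := M * / sqrt (m o) * / eta). assert (HD : 0 < D) by (unfold D; repeat apply Rmult_lt_0_compat; assumption).
  set (E := M * sqrt (m v)). assert (HE : 0 < E) by (apply Rmult_lt_0_compat; assumption).
  set (K1 := M + D * E). assert (HK1 : 0 < K1) by (unfold K1; nra).
  set (K2 := ((R0 + 1) * K1 + 1) * / sqrt (m v)).
  assert (HK2 : 0 < K2) by (apply Rmult_lt_0_compat; [nra|exact Hiv]).
  assert (HGne : G mu o v <> 0%C).
  { apply Cmod_gt_0; lra. }
  destruct (Green_spec adj o p Htree Hst mu M v Hreg) as [HG HLG]. fold E in HG.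
  assert (Hex : forall h r, bnd h r -> exists q c, bnd q (K1 * r) /\ q o = 0%C /\
     forall z, Lap mu q z = (h z + c * indicator v z)%C).
  { intros h r Hh. assert (Hr := bnd_pos _ _ _ _ _ Hh).
    destruct (Hsol h r Hh) as [g [Hg HgE]]. set (c := (- (g o / G mu o v))%C).
    assert (Hc : Cmod c <= D * r).
    { unfold c. rewrite Cmod_opp, Cmod_div by exact HGne.
      assert (Hgo := bnd_point adj o p Htree Hst _ _ o Hg).
      apply Rle_trans with ((M * r * / sqrt (m o)) * / eta); [|apply Req_le; unfold D; ring].
      apply Rmult_le_compat; [apply Cmod_ge_0| |exact Hgo|].
      - apply Rlt_le, Rinv_0_lt_compat, Cmod_gt_0, HGne.
      - apply Rinv_le_contravar; assumption. }
    exists (fun x => g x + c * G mu x v)%C, c. split; [|split].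
    - apply bnd_weaken with (M * r + D * r * E); [unfold K1; lra|].
      apply bnd_plus; [exact Htree|exact Hst|exact Hg|].
      apply bnd_scal with E; [|nra|exact HG]. apply Rmult_lt_0_compat; nra.
    - unfold c. field. exact HGne.
    - intros z. rewrite Lap_lin, HgE, HLG by (eapply bnd_p_summable; eassumption). ring. }
  split; [lra|]. split.
  - intros h r Hh. destruct (Hex h r Hh) as [q [c [Hq Hq']]]. exists q, c. split; [|exact Hq'].
    assert (Hr := bnd_pos _ _ _ _ _ Hh). apply bnd_weaken with (2 := Hq). nra.
  - intros q h c r A Hq Hqo Hh HL. assert (Hr := bnd_pos _ _ _ _ _ Hh).
    destruct (Hex h r Hh) as [q' [c' [Hq' [Hqo' HL']]]].
    assert (Hd : forall x, (q x - q' x)%C = ((c - c') * G mu x v)%C).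
    { apply (regular_unique adj o p Htree Hst mu M _ _ (A + K1 * r) ((Cmod (c - c') + 1) * E) Hreg).
      - apply bnd_minus; assumption.
      - assert (Hcc := Cmod_ge_0 (c - c')). apply bnd_scal with E; [nra|nra|exact HG].
      - intros x. rewrite Lap_minus, Lap_scal, HL, HL', HLG by (eapply bnd_p_summable; eassumption).
        ring. }
    assert (Hcc : (c - c')%C = 0%C).
    { assert (H := Hd o). rewrite Hqo, Hqo' in H.
      assert (H1 : ((c - c') * G mu o v)%C = 0%C) by (rewrite <- H; ring).
      apply Cmult_eq_0 in H1. tauto. }
    assert (Hqq : forall x, q' x = q x).
    { intros x. replace (q x) with (q' x + (q x - q' x))%C by ring. rewrite Hd, Hcc. ring. }
    assert (HqK : bnd q (K1 * r)) by (apply bnd_ext with (2 := Hq'); exact Hqq).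
    split; [apply bnd_weaken with (2 := HqK); nra|].
    assert (Ec : c = (Lap mu q v - h v)%C).
    { rewrite HL. unfold indicator. rewrite decide_true by reflexivity. ring. }
    rewrite Ec.
    assert (H1 := bnd_point adj o p Htree Hst _ _ v
       (bnd_minus adj o p Htree Hst _ _ _ _ (bnd_Lap adj o p Htree Hst mu _ _ HqK) Hh)).
    simpl in H1. eapply Rle_trans; [exact H1|].
    apply Rle_trans with (K2 * r); [|nra].
    unfold K2. replace (((R0 + 1) * K1 + 1) * / sqrt (m v) * r)
      with (((R0 + 1) * (K1 * r) + r) * / sqrt (m v)) by ring.
    apply Rmult_le_compat_r; [lra|].
    assert (0 < K1 * r) by nra. nra.
Qed.

(** On a small disc the previous constant can be taken with [2 M] for the inverse, half of
    [Cmod (G lam o v)] as lower bound [eta], and [Cmod lam + 1 / (2 M)] as bound for [mu]. *)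
Lemma pinned_regular_near lam M v : regular lam M -> G lam o v <> 0%C ->
  exists d K, 0 < d /\ forall mu, Cmod (mu - lam) < d ->
    (exists M', regular mu M') /\ G mu o v <> 0%C /\ pinned_regular v mu K.
Proof.
  intros Hreg H0. assert (HM : 0 < M) by apply Hreg.
  destruct (Green_near_nonzero lam M o v Hreg H0) as [d [Hd H]].
  assert (Hg : 0 < Cmod (G lam o v)) by (apply Cmod_gt_0, H0).
  eexists (Rmin d (/ (2 * M))), _. split; [apply Rmin_glb_lt; [exact Hd|apply Rinv_0_lt_compat; lra]|].
  intros mu Hmu.
  assert (Hmu1 : Cmod (mu - lam) < d) by (eapply Rlt_le_trans; [exact Hmu|apply Rmin_l]).
  assert (Hmu2 : Cmod (mu - lam) < / (2 * M)) by (eapply Rlt_le_trans; [exact Hmu|apply Rmin_r]).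
  specialize (H mu Hmu1).
  assert (Hregmu : regular mu (2 * M)).
  { apply (regular_near adj o p Htree Hst lam); [exact Hreg|].
    apply Rle_trans with (/ (2 * M) * M); [|apply Req_le; field; lra].
    apply Rmult_le_compat_r; lra. }
  split; [exists (2 * M); exact Hregmu|].
  split; [apply Cmod_gt_0; lra|].
  apply (pinned_regular_of_regular v mu (2 * M) (Cmod (G lam o v) / 2) (Cmod lam + / (2 * M)));
    [exact Hregmu| |lra|exact H].
  replace mu with (lam + (mu - lam))%C by ring.
  eapply Rle_trans; [apply Cmod_triangle|lra].
Qed.

End KernelDerivatives.

(** * The kernels and their derivatives as l^2-valued functions of [mu] *)

Section KernelChain.
Context {T : Type} (adj : T -> T -> Prop) (o : T) (p : T -> T -> R).
Hypothesis (Htree : is_tree adj) (Hst : stochastic adj p).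

Local Notation m := (mes adj o p).
Local Notation bnd := (bnd adj o p).
Local Notation G := (Green adj o p).
Local Notation regular := (regular adj o p).
Local Notation Lap := (Lap p).
Local Notation pinned_regular := (pinned_regular adj o p).

(* [W r mu] is the [r]-th [mu]-derivative of the kernel [G mu x v / G mu o v], which
   satisfies [(mu - P) W_0 = c_0 1_v] with [c_0 = 1 / G mu o v] and [W_0 o = 1]; formal
   differentiation gives [(mu - P) W_r = - r W_(r-1) + c_r 1_v] with [W_r o = 0], and these
   equations determine [W_r] and [c_r]. *)
Definition kernel_system (v : T) (lam : C) (d : R) (W : nat -> C -> T -> C) (c : nat -> C -> C) : Prop :=
  forall mu, Cmod (mu - lam) < d ->
    W 0%nat mu o = 1%C /\
    forall r, W (S r) mu o = 0%C /\ (exists A, bnd (W r mu) A) /\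
      forall z, Lap mu (W r mu) z
        = (- RtoC (INR r) * W (pred r) mu z + c r mu * indicator v z)%C.

Lemma kernel_system_exists lam d K v :
  (forall mu, Cmod (mu - lam) < d ->
    (exists M', regular mu M') /\ G mu o v <> 0%C /\ pinned_regular v mu K) ->
  exists W c, kernel_system v lam d W c /\
    (forall mu x, W 0%nat mu x = (G mu x v / G mu o v)%C) /\ (forall mu, c 0%nat mu = (/ G mu o v)%C).
Proof.
  intros H.
  assert (HS : forall mh : C * (T -> C), exists qc : (T -> C) * C,
     Cmod (fst mh - lam) < d -> (exists r, bnd (snd mh) r) ->
     (exists A, bnd (fst qc) A) /\ fst qc o = 0%C /\
     forall z, Lap (fst mh) (fst qc) z = (snd mh z + snd qc * indicator v z)%C).
  { intros [mu h]; simpl.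
    destruct (excluded_middle_informative (Cmod (mu - lam) < d /\ exists r, bnd h r)) as [[H1 [r H2]]|H1].
    - destruct (H mu H1) as [_ [_ [_ [Hex _]]]].
      destruct (Hex h r H2) as [q [c [Hq Hqc]]]. exists (q, c); intros _ _; simpl. split; [eauto|exact Hqc].
    - exists (h, RtoC 0); intros; tauto. }
  apply choice in HS. destruct HS as [F HF].
  (* Order 0 is explicit; each further order solves the pinned problem with right-hand side
     [- r W_(r-1)]. *)
  set (WC := fix WC r mu : (T -> C) * C := match r with
     | O => ((fun x => G mu x v / G mu o v), / G mu o v)%C
     | S r' => F (mu, fun x => - RtoC (INR r) * fst (WC r' mu) x)%C end).
  exists (fun r mu => fst (WC r mu)), (fun r mu => snd (WC r mu)).
  split; [|split; reflexivity]. intros mu Hmu.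
  destruct (H mu Hmu) as [[M' Hreg] [HG _]].
  destruct (Green_spec adj o p Htree Hst mu M' v Hreg) as [HGb HGL].
  assert (Hsc : forall f c, (exists A, bnd f A) -> exists A, bnd (fun x => c * f x)%C A).
  { intros f c [A HA]. exists (Cmod c * A + 1).
    assert (Hc := Cmod_ge_0 c). assert (HA0 := bnd_pos _ _ _ _ _ HA).
    apply bnd_scal with A; [nra|lra|exact HA]. }
  assert (Hb : forall r, exists A, bnd (fst (WC r mu)) A).
  { induction r as [|r IH].
    - simpl. destruct (Hsc (fun x => G mu x v) (/ G mu o v)%C) as [A HA]; [eauto|].
      exists A. apply bnd_ext with (2 := HA). intros x; unfold Cdiv; ring.
    - apply (HF (mu, fun x => - RtoC (INR (S r)) * fst (WC r mu) x)%C Hmu). apply Hsc, IH. }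
  split; [simpl; field; exact HG|]. intros r.
  split; [|split; [apply Hb|]].
  - apply (HF (mu, fun x => - RtoC (INR (S r)) * fst (WC r mu) x)%C Hmu). apply Hsc, Hb.
  - destruct r as [|r]; intros z.
    + simpl. rewrite (Lap_ext p mu _ (fun x => / G mu o v * G mu x v)%C) by (intros; unfold Cdiv; ring).
      rewrite Lap_scal, HGL by (eapply bnd_p_summable; eassumption). ring.
    + apply (HF (mu, fun x => - RtoC (INR (S r)) * fst (WC r mu) x)%C Hmu). apply Hsc, Hb.
Qed.

(** The remainder of order [r] vanishes at [o] and solves the pinned problem at the moving point
    [w], with right-hand side [- r] times the remainder of order [r - 1], minus
    [(w - mu)^2 W_(r+1)(mu)]. The former is small by induction, the latter is quadratic, and [K]
    does not depend on [w]. The case [w = mu] is left out because [bnd] demands a positive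
    number. *)
Lemma kernel_system_difference v lam d W c K mu :
  kernel_system v lam d W c ->
  (forall mu, Cmod (mu - lam) < d -> pinned_regular v mu K) ->
  Cmod (mu - lam) < d ->
  forall r e, 0 < e -> exists d', 0 < d' /\ forall w, w <> mu -> Cmod (w - mu) < d' ->
    bnd (fun x => W r w x - W r mu x - (w - mu) * W (S r) mu x)%C (e * Cmod (w - mu)) /\
    Cmod (c r w - c r mu - (w - mu) * c (S r) mu) <= e * Cmod (w - mu).
Proof.
  intros Hsys HK Hmu r; induction r as [r IHr] using (well_founded_induction Wf_nat.lt_wf); intros e He.
  assert (HKpos : 0 < K) by apply (HK mu Hmu).
  assert (Hdpos : forall w, w <> mu -> 0 < Cmod (w - mu)).
  { intros w Hw. apply Cmod_gt_0. intros E. apply Hw.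
    replace w with (mu + (w - mu))%C by ring. rewrite E; ring. }
  assert (Hprev : forall e', 0 < e' -> exists d', 0 < d' /\ forall w, w <> mu -> Cmod (w - mu) < d' ->
    bnd (fun x => - RtoC (INR r) * (W (pred r) w x - W (pred r) mu x - (w - mu) * W r mu x))%C
      (e' * Cmod (w - mu))).
  (* For [r = 0] the index [pred r] is again 0, but the factor [INR 0] removes the term. *)
  { intros e' He'. destruct r as [|r'].
    - exists 1; split; [lra|]. intros w Hw _. specialize (Hdpos w Hw).
      apply bnd_ext with (fun _ => RtoC 0); [intros; simpl; ring|].
      apply bnd_0, Rmult_lt_0_compat; assumption.
    - assert (Hn : 0 < INR (S r')) by (apply lt_0_INR; lia).
      destruct (IHr r' (Nat.lt_succ_diag_r r') (e' / INR (S r'))) as [d' [Hd' H]].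
      { apply Rdiv_lt_0_compat; assumption. }
      exists d'; split; [exact Hd'|]. intros w Hw Hwd. specialize (Hdpos w Hw).
      apply bnd_scal with (e' / INR (S r') * Cmod (w - mu)).
      + apply Rmult_lt_0_compat; assumption.
      + rewrite Cmod_opp, Cmod_R, Rabs_pos_eq by lra. apply Req_le; field; lra.
      + apply (proj1 (H w Hw Hwd)). }
  destruct (Hsys mu Hmu) as [Hmu0 Hmur].
  destruct (proj1 (proj2 (Hmur (S r)))) as [A HA]. assert (HA0 := bnd_pos _ _ _ _ _ HA).
  (* Two terms of size [e1 * Cmod (w - mu)] pass through the bound [K]. *)
  set (e1 := e / (2 * K)). assert (He1 : 0 < e1) by (apply Rdiv_lt_0_compat; lra).
  destruct (Hprev e1 He1) as [d1 [Hd1 H1]].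
  exists (Rmin d1 (Rmin (e1 / A) (d - Cmod (mu - lam)))). split.
  { repeat apply Rmin_glb_lt; [exact Hd1|apply Rdiv_lt_0_compat; assumption|lra]. }
  intros w Hw Hwd. specialize (Hdpos w Hw). specialize (H1 w Hw (Rlt_le_trans _ _ _ Hwd (Rmin_l _ _))).
  apply Rlt_le_trans with (2 := Rmin_r _ _) in Hwd.
  assert (HwA := Rlt_le_trans _ _ _ Hwd (Rmin_l _ _)).
  assert (Hwlam := Rlt_le_trans _ _ _ Hwd (Rmin_r _ _)).
  assert (Hwl : Cmod (w - lam) < d).
  { replace (w - lam)%C with ((w - mu) + (mu - lam))%C by ring.
    eapply Rle_lt_trans; [apply Cmod_triangle|lra]. }
  clear Hwd Hwlam. destruct (Hsys w Hwl) as [Hw0 Hwr].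
  destruct (Hwr r) as [Hwo [[B HB] HwL]]. destruct (Hmur r) as [Hmo [[B' HB'] HmL]].
  destruct (HK w Hwl) as [_ [_ Hpin]].
  set (D := (w - mu)%C) in *.
  assert (HDA : Cmod D * A <= e1).
  { apply Rmult_lt_compat_r with (r := A) in HwA; [|exact HA0].
    replace (e1 / A * A) with e1 in HwA by (field; lra). lra. }
  assert (HDW : bnd (fun x => D * W (S r) mu x)%C (Cmod D * A)).
  { apply bnd_scal with A; [apply Rmult_lt_0_compat; assumption|lra|exact HA]. }
  assert (HD2W : bnd (fun x => - (D * D) * W (S r) mu x)%C (e1 * Cmod D)).
  { apply bnd_scal with A; [apply Rmult_lt_0_compat; assumption| |exact HA].
    rewrite Cmod_opp, Cmod_mult. nra. }
  assert (Hq := Hpin (fun x => W r w x - W r mu x - D * W (S r) mu x)%C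
    (fun x => - RtoC (INR r) * (W (pred r) w x - W (pred r) mu x - D * W r mu x)
       + - (D * D) * W (S r) mu x)%C
    (c r w - c r mu - D * c (S r) mu)%C (e1 * Cmod D + e1 * Cmod D) (B + B' + Cmod D * A)).
  replace (K * (e1 * Cmod D + e1 * Cmod D)) with (e * Cmod D) in Hq by (unfold e1; field; lra).
  apply Hq; clear Hq.
  - apply bnd_minus; [exact Htree|exact Hst| |exact HDW]. apply bnd_minus; assumption.
  - rewrite (proj1 (Hmur r)). destruct r as [|r'].
    + rewrite Hw0, Hmu0. ring.
    + rewrite (proj1 (Hwr r')), (proj1 (Hmur r')). ring.
  - apply bnd_plus; assumption.
  - intros z.
    assert (HS := proj2 (proj2 (Hmur (S r))) z). simpl pred in HS. rewrite S_INR, RtoC_plus in HS.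
    rewrite (Lap_minus p w (fun x => W r w x - W r mu x)%C (fun x => D * W (S r) mu x)%C).
    + rewrite Lap_minus by (eapply bnd_p_summable; eassumption).
      rewrite Lap_scal by (eapply bnd_p_summable; eassumption).
      rewrite HwL, (Lap_shift p w mu (W r mu)), (Lap_shift p w mu (W (S r) mu)), HmL, HS.
      fold D. ring.
    + apply (bnd_p_summable adj o p Htree Hst _ (B + B')). apply bnd_minus; assumption.
    + apply (bnd_p_summable adj o p Htree Hst _ _ HDW).
Qed.

(** Evaluation at [x] costs a factor [1 / sqrt (m x)], so the l^2 remainder estimate gives pointwise
    derivatives; one disc serves all [x] and all orders. *)
Lemma kernel_derivatives lam M v : regular lam M -> G lam o v <> 0%C ->
  exists d W c, 0 < d /\ kernel_system v lam d W c /\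
    (forall mu x, W 0%nat mu x = (G mu x v / G mu o v)%C) /\
    (forall mu, c 0%nat mu = (/ G mu o v)%C) /\
    (forall x, deriv_chain lam d (fun r mu => W r mu x)) /\ deriv_chain lam d c.
Proof.
  intros Hreg HG.
  destruct (pinned_regular_near adj o p Htree Hst lam M v Hreg HG) as [d [K [Hd H]]].
  destruct (kernel_system_exists lam d K v H) as [W [c [Hsys [HW0 Hc0]]]].
  exists d, W, c. split; [exact Hd|]. split; [exact Hsys|]. split; [exact HW0|]. split; [exact Hc0|].
  assert (Hdiff := fun mu => kernel_system_difference v lam d W c K mu Hsys
     (fun mu' Hmu' => proj2 (proj2 (H mu' Hmu')))).
  split.
  - intros x r mu Hmu e He.
    assert (Hs : 0 < sqrt (m x)) by apply sqrt_lt_R0, (mes_pos adj o p Htree Hst).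
    destruct (Hdiff mu Hmu r (e * sqrt (m x))) as [d' [Hd' H']]; [apply Rmult_lt_0_compat; assumption|].
    exists d'; split; [exact Hd'|]. intros w Hw.
    destruct (excluded_middle_informative (w = mu)) as [->|Hne].
    + replace (W r mu x - W r mu x - (mu - mu) * W (S r) mu x)%C with (RtoC 0) by ring.
      rewrite Cmod_0. apply Rmult_le_pos; [lra|apply Cmod_ge_0].
    + assert (Hb := bnd_point adj o p Htree Hst _ _ x (proj1 (H' w Hne Hw))).
      eapply Rle_trans; [exact Hb|]. apply Req_le; field; lra.
  - intros r mu Hmu e He. destruct (Hdiff mu Hmu r e He) as [d' [Hd' H']].
    exists d'; split; [exact Hd'|]. intros w Hw.
    destruct (excluded_middle_informative (w = mu)) as [->|Hne].
    + replace (c r mu - c r mu - (mu - mu) * c (S r) mu)%C with (RtoC 0) by ring.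
      rewrite Cmod_0. apply Rmult_le_pos; [lra|apply Cmod_ge_0].
    + apply (H' w Hne Hw).
Qed.

(** * Derivatives at [lam] and the edge identities they satisfy *)

Section NonzeroDiagonal.
Context (lam : C) (M : R).
Hypothesis (Hreg : regular lam M) (Hdiag : forall x, G lam x x <> 0%C).

(** The value [K^(r)(x, xi)] for ends [xi] whose last common vertex with the path to [x] is [v].
    Allowing every vertex [v] makes it a function of [x] on all of [T], to which [lam - P] can be
    applied. *)
Definition kernel_deriv (r : nat) (x v : T) : C :=
  CDerive_n r (fun mu => G mu x v / G mu o v)%C lam.

(** The coefficient of [1_v] in the image of [K^(r)(., v)] under [lam - P]. *)
Definition defect_deriv (r : nat) (v : T) : C := CDerive_n r (fun mu => / G mu o v)%C lam.

Let HGo : forall v, G lam o v <> 0%C := Green_o_nonzero adj o p Htree Hst lam M Hreg Hdiag.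

Lemma near_lam_self d : 0 < d -> Cmod (lam - lam) < d.
Proof. replace (lam - lam)%C with (RtoC 0) by ring. rewrite Cmod_0; tauto. Qed.

Lemma kernel_deriv_p_summable r v : p_summable p (fun x => kernel_deriv r x v).
Proof.
  destruct (kernel_derivatives lam M v Hreg (HGo v)) as [d [W [c [Hd [Hsys [HW0 [Hc0 [HW Hc]]]]]]]].
  destruct (proj2 (Hsys lam (near_lam_self d Hd)) r) as [_ [[A HA] _]].
  apply (bnd_p_summable adj o p Htree Hst _ A). apply bnd_ext with (2 := HA). intros x.
  symmetry. apply (CDerive_n_chain lam d (fun r mu => W r mu x)); auto using near_lam_self.
Qed.

Lemma Lap_kernel_deriv r v z :
  Lap lam (fun x => kernel_deriv r x v) z =
  (- RtoC (INR r) * kernel_deriv (pred r) z v + defect_deriv r v * indicator v z)%C.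
Proof.
  destruct (kernel_derivatives lam M v Hreg (HGo v)) as [d [W [c [Hd [Hsys [HW0 [Hc0 [HW Hc]]]]]]]].
  assert (HWK : forall r x, kernel_deriv r x v = W r lam x).
  { intros r' x. apply (CDerive_n_chain lam d (fun r mu => W r mu x)); auto using near_lam_self. }
  rewrite (Lap_ext p lam _ (W r lam)) by apply HWK. rewrite HWK.
  replace (defect_deriv r v) with (c r lam); [apply (Hsys lam (near_lam_self d Hd))|].
  symmetry. apply (CDerive_n_chain lam d c); auto using near_lam_self.
Qed.

(** An identity can be differentiated only if it holds on a disc. For a fixed edge finitely many
    nonvanishing conditions are involved, and continuity carries them from [lam] to nearby [mu]. *)
Lemma kernels_near x y : is_child adj o y x -> exists d, 0 < d /\
  forall mu, Cmod (mu - lam) < d ->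
    (exists M', regular mu M') /\ G mu x x <> 0%C /\ G mu o x <> 0%C /\ G mu o y <> 0%C.
Proof.
  intros Hc.
  destruct (pinned_regular_near adj o p Htree Hst lam M x Hreg (HGo x)) as [d1 [K1 [Hd1 H1]]].
  destruct (pinned_regular_near adj o p Htree Hst lam M y Hreg (HGo y)) as [d2 [K2 [Hd2 H2]]].
  destruct (Green_near_nonzero adj o p Htree Hst lam M x x Hreg (Hdiag x)) as [d3 [Hd3 H3]].
  exists (Rmin d1 (Rmin d2 d3)). split; [repeat apply Rmin_glb_lt; assumption|]. intros mu Hmu.
  assert (E1 := Rlt_le_trans _ _ _ Hmu (Rmin_l _ _)).
  apply Rlt_le_trans with (2 := Rmin_r _ _) in Hmu.
  assert (E2 := Rlt_le_trans _ _ _ Hmu (Rmin_l _ _)).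
  assert (E3 := Rlt_le_trans _ _ _ Hmu (Rmin_r _ _)).
  destruct (H1 mu E1) as [Hr [Ho _]]. destruct (H2 mu E2) as [_ [Ho' _]]. specialize (H3 mu E3).
  repeat split; auto. apply Cmod_gt_0.
  assert (Hp := proj1 (Cmod_gt_0 _) (Hdiag x)). lra.
Qed.

Lemma kernel_deriv_edge r x y : is_child adj o y x ->
  (RtoC (p x y) * (kernel_deriv r y y - kernel_deriv r y x))%C = defect_deriv r x.
Proof.
  intros Hch. destruct (kernels_near x y Hch) as [d0 [Hd0 Hnear]].
  destruct (kernel_derivatives lam M x Hreg (HGo x)) as [d1 [W1 [c1 [Hd1 [_ [HW10 [_ [HW1 _]]]]]]]].
  destruct (kernel_derivatives lam M y Hreg (HGo y)) as [d2 [W2 [c2 [Hd2 [_ [HW20 [_ [HW2 _]]]]]]]].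
  set (d := Rmin d0 (Rmin d1 d2)).
  assert (Hd : 0 < d) by (repeat apply Rmin_glb_lt; assumption).
  assert (Hl0 : d <= d0) by apply Rmin_l.
  assert (Hl1 : d <= d1) by (eapply Rle_trans; [apply Rmin_r|apply Rmin_l]).
  assert (Hl2 : d <= d2) by (eapply Rle_trans; [apply Rmin_r|apply Rmin_r]).
  unfold defect_deriv.
  rewrite (CDerive_n_chain lam d (fun r mu => RtoC (p x y) * (W2 r mu y - W1 r mu y))%C).
  - f_equal. f_equal.
    + apply (CDerive_n_chain lam d2 (fun r mu => W2 r mu y)); auto using near_lam_self.
    + apply (CDerive_n_chain lam d1 (fun r mu => W1 r mu y)); auto using near_lam_self.
  - apply deriv_chain_diff.
    + apply (deriv_chain_shrink lam d2); [exact Hl2|apply HW2].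
    + apply (deriv_chain_shrink lam d1); [exact Hl1|apply HW1].
  - intros w Hw. rewrite HW10, HW20. symmetry.
    destruct (Hnear w) as [[M' HM'] [Hx [Hox Hoy]]]; [lra|].
    apply (kernel_edge adj o p Htree Hst w M' HM'); assumption.
  - apply near_lam_self, Hd.
Qed.

Lemma kernel_deriv_parent r x y : is_child adj o y x -> kernel_deriv r x y = kernel_deriv r x x.
Proof.
  intros Hch. destruct (kernels_near x y Hch) as [d0 [Hd0 Hnear]].
  destruct (kernel_derivatives lam M x Hreg (HGo x)) as [d1 [W1 [c1 [Hd1 [_ [HW10 [_ [HW1 _]]]]]]]].
  assert (Hd : 0 < Rmin d0 d1) by (apply Rmin_glb_lt; assumption).
  transitivity (W1 r lam x); [|symmetry];
    apply (CDerive_n_chain lam (Rmin d0 d1) (fun r mu => W1 r mu x));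
    try (apply near_lam_self, Hd);
    try (apply (deriv_chain_shrink lam d1); [apply Rmin_r|apply HW1]).
  - intros w Hw. rewrite HW10.
    destruct (Hnear w) as [[M' HM'] [Hx [Hox Hoy]]]; [eapply Rlt_le_trans; [exact Hw|apply Rmin_l]|].
    apply (kernel_parent adj o p Htree Hst w M' HM'); assumption.
  - intros w Hw. symmetry; apply HW10.
Qed.

End NonzeroDiagonal.
End KernelChain.

(** * Finite combinations and iterates of [lam - P] *)

Section FiniteCombinations.
Context {T : Type} (p : T -> T -> R).
Local Open Scope C_scope.

Lemma p_summable_lsumC {U : Type} (F : U -> T -> C) (L : list U) :
  (forall a, In a L -> p_summable p (F a)) -> p_summable p (fun z => lsumC (fun a => F a z) L).
Proof.
  induction L as [|a L IH]; intros H; simpl.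
  - intros x. apply (abs_summable_single x). intros; ring.
  - apply p_summable_plus; [apply H; left; reflexivity|]. apply IH; intros; apply H; right; assumption.
Qed.

Lemma Lap_lsumC {U : Type} mu (F : U -> T -> C) (L : list U) x :
  (forall a, In a L -> p_summable p (F a)) ->
  Lap p mu (fun z => lsumC (fun a => F a z) L) x = lsumC (fun a => Lap p mu (F a) x) L.
Proof.
  induction L as [|a L IH]; intros H; simpl.
  - unfold Lap, Pop. rewrite (usum_single x); [ring|]. intros; ring.
  - rewrite Lap_plus.
    + rewrite IH; [reflexivity|]. intros; apply H; right; assumption.
    + apply H; left; reflexivity.
    + apply p_summable_lsumC; intros; apply H; right; assumption.
Qed.

Lemma Lapn_Lap lam k f : Lapn p lam k (Lap p lam f) = Lap p lam (Lapn p lam k f).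
Proof. induction k as [|k IH]; [reflexivity|]. simpl. rewrite IH; reflexivity. Qed.

(** [Lapn] adds operators on the outside, whereas the induction on [n] replaces [f] by its image
    under [lam - P]; the two orders agree because the operators are powers of one another. *)
Lemma polyharmonic_S lam n f :
  polyharmonic p lam (S n) f <-> p_summable p f /\ polyharmonic p lam n (Lap p lam f).
Proof.
  unfold polyharmonic. split.
  - intros [H1 H2]. split; [intros x; apply (H1 0%nat); lia|]. split.
    + intros k Hk x. rewrite Lapn_Lap. apply (H1 (S k)); lia.
    + intros x. rewrite Lapn_Lap. apply H2.
  - intros [H0 [H1 H2]]. split.
    + intros [|k] Hk x; [apply H0|]. simpl. rewrite <- Lapn_Lap. apply H1; lia.
    + intros x. simpl. rewrite <- Lapn_Lap. apply H2.
Qed.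

Lemma lsumC_seq_S (g : nat -> C) n :
  lsumC g (seq 0 (S n)) = g 0%nat + lsumC (fun r => g (S r)) (seq 0 n).
Proof.
  simpl. f_equal. rewrite <- seq_shift. induction (seq 0 n); simpl; congruence.
Qed.

End FiniteCombinations.

(** * Integrals of locally constant functions as sums along a path *)

Section BoundaryIntegrals.
Context {T : Type} (adj : T -> T -> Prop) (o : T) (p : T -> T -> R).
Hypothesis (Htree : is_tree adj) (Hst : stochastic adj p).
Local Open Scope C_scope.

Local Notation geo := (geo adj o).
Local Notation is_child := (is_child adj o).
Local Notation distribution := (distribution adj o).

(** For [v] on the path to [x], the mass of the ends that leave this path at [v]. *)
Definition end_weight (nu : T -> C) (x v : T) : C :=
  nu v - lsumC (fun y => if decide (is_child y v) then nu y else 0) (geo x).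

(** The integrand [kappa] is kept independent of the endpoint [x], so that kernels at neighbouring
    points can be integrated along one and the same path. *)
Definition path_integral (nu : T -> C) (kappa : T -> C) (x : T) : C :=
  lsumC (fun v => kappa v * end_weight nu x v) (geo x).

Lemma end_weight_self nu x : end_weight nu x x = nu x.
Proof.
  unfold end_weight. rewrite (lsumC_ext _ (fun _ => RtoC 0)), lsumC_0; [ring|].
  intros y Hy. rewrite decide_false; [reflexivity|]. intros H.
  apply (child_not_In adj o Htree _ _ H Hy).
Qed.

Lemma path_integral_o nu kappa : path_integral nu kappa o = kappa o * nu o.
Proof.
  unfold path_integral. rewrite (geo_o adj o Htree). simpl. rewrite end_weight_self. ring.
Qed.

(** Extending the path by [y] moves the mass [nu y] from [x] to [y] and changes nothing else;
    iterated, this is summation by parts. *)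
Lemma path_integral_child nu kappa x y : is_child y x ->
  path_integral nu kappa y = path_integral nu kappa x + (kappa y - kappa x) * nu y.
Proof.
  intros Hc. unfold path_integral.
  assert (Hg := proj1 (child_iff adj o Htree _ _) Hc).
  rewrite Hg at 1. rewrite lsumC_app. simpl. rewrite end_weight_self.
  rewrite (lsumC_ext _ (fun v => kappa v * end_weight nu x v
     + (-1) * (kappa v * (if decide (is_child y v) then nu y else 0)))).
  - rewrite lsumC_plus, lsumC_scal.
    rewrite (lsumC_single (fun v => kappa v * (if decide (is_child y v) then nu y else 0)) x).
    + rewrite decide_true by exact Hc. ring.
    + apply (geo_NoDup adj o Htree).
    + apply (In_geo_self adj o Htree).
    + intros v Hv. rewrite decide_false; [ring|]. intros H; apply Hv.
      apply (child_parent_unique adj o _ _ _ H Hc).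
  - intros v _. unfold end_weight. rewrite Hg, lsumC_app. simpl. ring.
Qed.

Lemma path_integral_ext nu kappa kappa' x : (forall v, In v (geo x) -> kappa v = kappa' v) ->
  path_integral nu kappa x = path_integral nu kappa' x.
Proof. intros H. apply lsumC_ext. intros v Hv. rewrite H by exact Hv. reflexivity. Qed.

Lemma path_integral_plus nu kappa kappa' x :
  path_integral nu (fun v => kappa v + kappa' v) x
  = path_integral nu kappa x + path_integral nu kappa' x.
Proof. unfold path_integral. rewrite <- lsumC_plus. apply lsumC_ext; intros; ring. Qed.

Lemma path_integral_scal nu c kappa x :
  path_integral nu (fun v => c * kappa v) x = c * path_integral nu kappa x.
Proof. unfold path_integral. rewrite <- lsumC_scal. apply lsumC_ext; intros; ring. Qed.

Lemma path_integral_indicator nu c x :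
  path_integral nu (fun v => c v * indicator v x) x = c x * nu x.
Proof.
  unfold path_integral. rewrite (lsumC_single _ x).
  - rewrite end_weight_self. unfold indicator. rewrite decide_true by reflexivity. ring.
  - apply (geo_NoDup adj o Htree).
  - apply (In_geo_self adj o Htree).
  - intros v Hv. unfold indicator. rewrite decide_false by congruence. ring.
Qed.

Lemma path_integral_lin a nu nu' kappa x :
  path_integral (fun v => a * nu v + nu' v) kappa x
  = a * path_integral nu kappa x + path_integral nu' kappa x.
Proof.
  induction x as [|x y Hc IH] using (tree_ind adj o Htree).
  - rewrite !path_integral_o. ring.
  - rewrite !(path_integral_child _ _ _ _ Hc), IH. ring.
Qed.

Lemma path_integral_0 kappa x : path_integral (fun _ => 0) kappa x = 0.
Proof.
  induction x as [|x y Hc IH] using (tree_ind adj o Htree).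
  - rewrite path_integral_o. ring.
  - rewrite (path_integral_child _ _ _ _ Hc), IH. ring.
Qed.

Lemma distribution_lin a nu nu' : distribution nu -> distribution nu' ->
  distribution (fun v => a * nu v + nu' v).
Proof.
  intros H H' x. destruct (H x) as [H1 H2], (H' x) as [H1' H2'].
  assert (E : forall y, a * (if decide (is_child y x) then nu y else 0)
     + (if decide (is_child y x) then nu' y else 0)
     = (if decide (is_child y x) then a * nu y + nu' y else 0)).
  { intros y. case_decide; ring. }
  split.
  - apply (abs_summable_ext _ _ E). apply abs_summable_plus; [apply abs_summable_scal, H1|exact H1'].
  - rewrite H2, H2', <- (usum_ext _ _ _ E).
    rewrite usum_plus, usum_scal; auto using abs_summable_scal.
Qed.

Lemma distribution_0 : distribution (fun _ => 0).
Proof.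
  intros x. split.
  - apply (abs_summable_single x). intros; case_decide; reflexivity.
  - rewrite (usum_single x); [|intros]; case_decide; reflexivity.
Qed.

(** * Integrals of the kernels: the action of [lam - P], injectivity and representation *)

Section KernelIntegrals.
Context (lam : C) (M : R).
Hypothesis (Hnl : no_leaves adj).
Hypothesis (Hreg : regular adj o p lam M) (Hdiag : forall x, Green adj o p lam x x <> 0).

Local Notation G := (Green adj o p lam).
Local Notation Lap := (Lap p lam).
Local Notation kernel_deriv := (kernel_deriv adj o p lam).
Local Notation defect_deriv := (defect_deriv adj o p lam).

Let HGo : forall v, G o v <> 0 := Green_o_nonzero adj o p Htree Hst lam M Hreg Hdiag.

Lemma exists_neighbour x : exists y, adj x y.
Proof.
  apply Classical_Prop.NNPP; intros H.
  destruct (proj2 (proj2 Hst) x) as [_ E].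
  rewrite (usum_single x) in E.
  - rewrite (p_nonadj adj p Hst) in E; [apply RtoC_inj in E; lra|]. intros Hx; apply H; eauto.
  - intros y _. rewrite (p_nonadj adj p Hst); [reflexivity|]. intros Hx; apply H; eauto.
Qed.

Definition kernel_integral (r : nat) (nu : T -> C) (x : T) : C :=
  path_integral nu (kernel_deriv r x) x.

(* Where [pick_end] is arbitrary, the weight of the corresponding set of ends vanishes. *)
Lemma integral_lc_kernel r nu x : distribution nu ->
  integral_lc adj o (geo x) (fun xi => Kern_r adj o p r x xi lam) nu = kernel_integral r nu x.
Proof.
  intros Hnu. apply lsumC_ext. intros v Hv.
  destruct (meet_pick_end adj o Htree Hnl exists_neighbour x v Hv) as [E|[c [Hc [Hcx Hu]]]].
  - unfold Kern_r, Kern. rewrite E. reflexivity.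
  - assert (Hother : forall y, y <> c -> (if decide (is_child y v) then nu y else 0) = 0).
    { intros y Hy. rewrite decide_false; [reflexivity|]. intros H; apply Hy, Hu, H. }
    assert (E : end_weight nu x v = 0).
    { unfold end_weight. rewrite (proj2 (Hnu v)), (usum_single c _ Hother).
      rewrite (lsumC_single _ c (geo x) (geo_NoDup adj o Htree x) Hcx Hother). ring. }
    change (Kern_r adj o p r x (pick_end adj o (geo x) v) lam * end_weight nu x v
       = kernel_deriv r x v * end_weight nu x v).
    rewrite E; ring.
Qed.

Lemma path_kernel_p_summable r nu x :
  p_summable p (fun z => path_integral nu (kernel_deriv r z) x).
Proof.
  apply (p_summable_lsumC p (fun v z => kernel_deriv r z v * end_weight nu x v)). intros v _.
  apply (p_summable_ext p (fun z => end_weight nu x v * kernel_deriv r z v)); [intros; ring|].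
  apply p_summable_scal, (kernel_deriv_p_summable adj o p Htree Hst lam M Hreg Hdiag).
Qed.

(** With the path frozen at [x], the integral is a finite combination of the functions
    [K^(r)(., v)]; evaluated at [x], only the multiple of [1_v] with [v = x] survives. *)
Lemma Lap_path_kernel r nu x :
  Lap (fun z => path_integral nu (kernel_deriv r z) x) x
  = - RtoC (INR r) * kernel_integral (pred r) nu x + defect_deriv r x * nu x.
Proof.
  assert (Hs := kernel_deriv_p_summable adj o p Htree Hst lam M Hreg Hdiag r).
  unfold path_integral.
  rewrite (Lap_lsumC p lam (fun v z => kernel_deriv r z v * end_weight nu x v)).
  - rewrite <- path_integral_indicator. unfold kernel_integral.
    rewrite <- path_integral_scal, <- path_integral_plus. apply lsumC_ext. intros v _.
    rewrite (Lap_ext p lam _ (fun z => end_weight nu x v * kernel_deriv r z v)) by (intros; ring).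
    rewrite Lap_scal by apply Hs.
    rewrite (Lap_kernel_deriv adj o p Htree Hst lam M Hreg Hdiag). ring.
  - intros v _.
    apply (p_summable_ext p (fun z => end_weight nu x v * kernel_deriv r z v)); [intros; ring|].
    apply p_summable_scal, Hs.
Qed.

(** Replacing the path of [y] by that of [x] costs [(K^(r)(y,y) - K^(r)(y,x)) nu y] for a child [y],
    which [kernel_deriv_edge] turns into a constant independent of [y]. For the parent it costs
    nothing, since then [K^(r)(y,x) = K^(r)(y,y)]. *)
Lemma p_kernel_integral r nu x y :
  RtoC (p x y) * kernel_integral r nu y
  = RtoC (p x y) * path_integral nu (kernel_deriv r y) x
    + defect_deriv r x * (if decide (is_child y x) then nu y else 0).
Proof.
  unfold kernel_integral.
  destruct (excluded_middle_informative (adj x y)) as [Hxy|Hxy].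
  - destruct (adj_child adj o Htree _ _ Hxy) as [H|H].
    + rewrite decide_true by exact H. rewrite (path_integral_child _ _ _ _ H).
      rewrite <- (kernel_deriv_edge adj o p Htree Hst lam M Hreg Hdiag r x y H). ring.
    + rewrite decide_false by (apply (child_asym adj o Htree _ _ H)).
      rewrite (path_integral_child _ _ _ _ H).
      rewrite (kernel_deriv_parent adj o p Htree Hst lam M Hreg Hdiag r y x H). ring.
  - rewrite (p_nonadj adj p Hst _ _ Hxy), decide_false; [ring|].
    intros H; apply Hxy, (child_adj adj o Htree), H.
Qed.

Lemma kernel_integral_p_summable r nu : distribution nu -> p_summable p (kernel_integral r nu).
Proof.
  intros Hnu x. eapply abs_summable_ext; [intros y; symmetry; apply p_kernel_integral|].
  apply abs_summable_plus; [apply path_kernel_p_summable|]. apply abs_summable_scal, Hnu.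
Qed.

Lemma Lap_kernel_integral r nu x : distribution nu ->
  Lap (kernel_integral r nu) x = - RtoC (INR r) * kernel_integral (pred r) nu x.
Proof.
  intros Hnu.
  assert (E : Pop p (kernel_integral r nu) x
     = Pop p (fun z => path_integral nu (kernel_deriv r z) x) x + defect_deriv r x * nu x).
  { unfold Pop. rewrite (usum_ext _ _ _ (p_kernel_integral r nu x)).
    rewrite usum_plus, usum_scal.
    (* Additivity of [nu] at [x] sums the contributions of the children to [nu x]. *)
    - rewrite <- (proj2 (Hnu x)). reflexivity.
    - apply Hnu.
    - apply path_kernel_p_summable.
    - apply abs_summable_scal, Hnu. }
  assert (E1 := Lap_path_kernel r nu x). unfold Defs.Lap in *. rewrite E.
  change (kernel_integral r nu x) with (path_integral nu (kernel_deriv r x) x).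
  replace (- RtoC (INR r) * kernel_integral (pred r) nu x)
    with (- RtoC (INR r) * kernel_integral (pred r) nu x + defect_deriv r x * nu x
      - defect_deriv r x * nu x) by ring.
  rewrite <- E1. ring.
Qed.

Lemma kernel_integral_0_o nu : kernel_integral 0 nu o = nu o.
Proof.
  unfold kernel_integral. rewrite path_integral_o. change (kernel_deriv 0 o o) with (G o o / G o o).
  field. apply Hdiag.
Qed.

(** By [kernel_child], the mass on the path to [x] contributes [G y x / G x x] times the integral at
    [x]; what remains is a nonzero multiple of [nu y]. Solved for [nu y], this is the recursion
    behind both uniqueness and existence. *)
Lemma kernel_integral_0_child nu x y : is_child y x ->
  nu y = RtoC (p x y) * G o x * (kernel_integral 0 nu y - G y x / G x x * kernel_integral 0 nu x).
Proof.
  intros Hc. unfold kernel_integral. rewrite (path_integral_child _ _ _ _ Hc).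
  rewrite (path_integral_ext nu (kernel_deriv 0 y) (fun v => G y x / G x x * kernel_deriv 0 x v) x).
  - rewrite path_integral_scal.
    assert (E := kernel_edge adj o p Htree Hst lam M Hreg x y Hc (Hdiag x) (HGo x) (HGo y)).
    change (kernel_deriv 0 y y) with (G y y / G o y).
    change (kernel_deriv 0 y x) with (G y x / G o x).
    transitivity (G o x * (RtoC (p x y) * (G y y / G o y - G y x / G o x)) * nu y); [|ring].
    rewrite E. field. apply HGo.
  - intros v Hv. apply (kernel_child adj o p Htree Hst lam M Hreg); auto.
Qed.

Lemma kernel_integral_0_injective nu :
  (forall x, kernel_integral 0 nu x = 0) -> forall x, nu x = 0.
Proof.
  intros H x. induction x as [|x y Hc _] using (tree_ind adj o Htree).
  - rewrite <- kernel_integral_0_o. apply H.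
  - rewrite (kernel_integral_0_child nu x y Hc), !H. ring.
Qed.

Lemma harmonic_representation h : p_summable p h -> (forall x, Lap h x = 0) ->
  exists nu, distribution nu /\ forall x, h x = kernel_integral 0 nu x.
Proof.
  intros Hs Hh.
  (* The recursion of [kernel_integral_0_child] with [h] in place of the integral; it makes the two
     agree by induction along edges. *)
  set (nu := fun y => if decide (y = o) then h o else
     let x := pred_v adj o y in RtoC (p x y) * G o x * (h y - G y x / G x x * h x)).
  assert (Hp : forall x y, is_child y x -> RtoC (p x y) <> 0).
  { intros x y Hc E. apply RtoC_inj in E.
    assert (H := p_pos adj p Hst _ _ (child_adj adj o Htree _ _ Hc)). lra. }
  assert (E : forall x, h x = kernel_integral 0 nu x).
  { intros x. induction x as [|x y Hc IH] using (tree_ind adj o Htree).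
    - rewrite kernel_integral_0_o. unfold nu. rewrite decide_true by reflexivity. reflexivity.
    - assert (H1 := kernel_integral_0_child nu x y Hc).
      rewrite <- IH in H1. destruct Hc as [Hy Hpr]. unfold nu at 1 in H1.
      rewrite decide_false, Hpr in H1 by exact Hy. cbv zeta in H1.
      assert (H2 : RtoC (p x y) * G o x * (h y - kernel_integral 0 nu y) = 0).
      { transitivity (RtoC (p x y) * G o x * (h y - G y x / G x x * h x)
          - RtoC (p x y) * G o x * (kernel_integral 0 nu y - G y x / G x x * h x)); [ring|].
        rewrite H1. ring. }
      apply Cmult_eq_0 in H2. destruct H2 as [H2|H2].
      + apply Cmult_eq_0 in H2. exfalso. destruct H2 as [H2|H2]; [|apply (HGo _ H2)].
        apply (Hp x y); [split; assumption|exact H2].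
      + replace (h y) with (kernel_integral 0 nu y + (h y - kernel_integral 0 nu y)) by ring.
        rewrite H2; ring. }
  exists nu; split; [|exact E]. intros x.
  assert (Hc : defect_deriv 0 x <> 0).
  { change (defect_deriv 0 x) with (/ G o x). intros H.
    apply C1_nz. rewrite <- (Cinv_r (G o x)) by apply HGo. rewrite H. ring. }
  set (Phi := fun z => path_integral nu (kernel_deriv 0 z) x).
  assert (HPhi : p_summable p Phi) by apply path_kernel_p_summable.
  (* [p_kernel_integral] solved for the masses of the children: absolute convergence then comes from
     that of [P h], and additivity from [(lam - P) h = 0] at [x]. *)
  assert (Epw : forall y, / defect_deriv 0 x * (RtoC (p x y) * h y + (-1) * (RtoC (p x y) * Phi y))
     = (if decide (is_child y x) then nu y else 0)).
  { intros y. rewrite E, p_kernel_integral. fold (Phi y). field. exact Hc. }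
  assert (Hs' := abs_summable_scal (-1) _ (HPhi x)).
  split.
  - apply (abs_summable_ext _ _ Epw). apply abs_summable_scal, abs_summable_plus; [apply Hs|exact Hs'].
  - rewrite <- (usum_ext _ _ _ Epw). rewrite usum_scal by (apply abs_summable_plus; [apply Hs|exact Hs']).
    rewrite usum_plus by (apply Hs || exact Hs'). rewrite usum_scal by apply HPhi.
    assert (H1 := Lap_path_kernel 0 nu x). fold Phi in H1.
    assert (H2 := Hh x). unfold Defs.Lap, Pop in H1, H2.
    assert (HPx : Phi x = h x) by (rewrite E; reflexivity).
    rewrite HPx in H1. simpl INR in H1.
    set (a := usum (fun y => RtoC (p x y) * h y)) in *.
    set (b := usum (fun y => RtoC (p x y) * Phi y)) in *.
    transitivity (/ defect_deriv 0 x * (defect_deriv 0 x * nu x)); [field; exact Hc|].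
    f_equal. transitivity (lam * h x - b - (lam * h x - a)); [|ring].
    rewrite H1, H2. ring.
Qed.

Definition kernel_sum (n : nat) (nu : nat -> T -> C) (x : T) : C :=
  lsumC (fun r => kernel_integral r (nu r) x) (seq 0 n).

Lemma represent_kernel_sum n nu x : (forall r, (r < n)%nat -> distribution (nu r)) ->
  represent adj o p lam n nu x = kernel_sum n nu x.
Proof.
  intros Hnu. apply (lsumC_ext (fun r =>
    integral_lc adj o (geo x) (fun xi => Kern_r adj o p r x xi lam) (nu r))).
  intros r Hr. apply in_seq in Hr. apply integral_lc_kernel, Hnu. lia.
Qed.

Lemma kernel_sum_S n nu x : kernel_sum (S n) nu x
  = kernel_integral 0 (nu 0%nat) x + lsumC (fun r => kernel_integral (S r) (nu (S r)) x) (seq 0 n).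
Proof. apply lsumC_seq_S. Qed.

Lemma kernel_sum_p_summable n nu : (forall r, (r < n)%nat -> distribution (nu r)) ->
  p_summable p (kernel_sum n nu).
Proof.
  intros Hnu. apply (p_summable_lsumC p (fun r => kernel_integral r (nu r))).
  intros r Hr. apply in_seq in Hr. apply kernel_integral_p_summable, Hnu. lia.
Qed.

(** The distributions obtained after one application of [lam - P], which sends [K^(r+1)] to
    [- (r + 1) K^(r)]. The final [+ 0] matches the form [a * nu + nu'] of the linearity lemmas. *)
Definition shift (nu : nat -> T -> C) (r : nat) (x : T) : C := - RtoC (INR (S r)) * nu (S r) x + 0.

Lemma shift_distribution n nu : (forall r, (r < S n)%nat -> distribution (nu r)) ->
  forall r, (r < n)%nat -> distribution (shift nu r).
Proof.
  intros Hnu r Hr. apply (distribution_lin _ _ (fun _ => 0)); [apply Hnu; lia|apply distribution_0].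
Qed.

Lemma Lap_kernel_sum n nu x : (forall r, (r < S n)%nat -> distribution (nu r)) ->
  Lap (kernel_sum (S n) nu) x = kernel_sum n (shift nu) x.
Proof.
  intros Hnu. unfold kernel_sum at 1.
  rewrite (Lap_lsumC p lam (fun r => kernel_integral r (nu r))).
  - rewrite lsumC_seq_S, Lap_kernel_integral by (apply Hnu; lia).
    (* The term of order 0 is harmonic: its factor [INR 0] is zero. *)
    replace (- RtoC (INR 0)) with (RtoC 0) by (simpl; ring). unfold kernel_sum.
    rewrite (lsumC_ext (fun r => Lap (kernel_integral (S r) (nu (S r))) x)
      (fun r => kernel_integral r (shift nu r) x)); [ring|].
    intros r Hr. apply in_seq in Hr. rewrite Lap_kernel_integral by (apply Hnu; lia).
    unfold kernel_integral, shift. rewrite path_integral_lin, path_integral_0. simpl pred. ring.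
  - intros r Hr. apply in_seq in Hr. apply kernel_integral_p_summable, Hnu. lia.
Qed.

Lemma kernel_sum_polyharmonic n nu : (forall r, (r < n)%nat -> distribution (nu r)) ->
  polyharmonic p lam n (kernel_sum n nu).
Proof.
  revert nu; induction n as [|n IH]; intros nu Hnu.
  - split; [intros; lia|]. reflexivity.
  - apply polyharmonic_S. split; [apply kernel_sum_p_summable, Hnu|].
    replace (Lap (kernel_sum (S n) nu)) with (kernel_sum n (shift nu)).
    + apply IH, shift_distribution, Hnu.
    + apply functional_extensionality; intros x. symmetry; apply Lap_kernel_sum, Hnu.
Qed.

(** Applying [lam - P] shifts the orders down, so induction removes all [nu r] with [r >= 1]; the
    remaining integral has order 0. *)
Lemma kernel_sum_injective n nu : (forall r, (r < n)%nat -> distribution (nu r)) ->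
  (forall x, kernel_sum n nu x = 0) -> forall r, (r < n)%nat -> forall x, nu r x = 0.
Proof.
  revert nu; induction n as [|n IH]; intros nu Hnu H0 r Hr; [lia|].
  assert (Hpos : forall r, (r < n)%nat -> forall x, nu (S r) x = 0).
  { intros r' Hr' x.
    assert (H1 : shift nu r' x = 0).
    { apply IH; [apply shift_distribution, Hnu| |exact Hr']. intros z.
      rewrite <- Lap_kernel_sum by exact Hnu.
      rewrite (Lap_ext p lam _ (fun _ => 0) z H0).
      unfold Defs.Lap, Pop. rewrite (usum_single z); intros; ring. }
    unfold shift in H1. rewrite Cplus_0_r in H1. apply Cmult_eq_0 in H1.
    destruct H1 as [H1|H1]; [|exact H1].
    exfalso. rewrite <- RtoC_opp in H1. apply RtoC_inj in H1.
    assert (Hn := lt_0_INR (S r') (Nat.lt_0_succ r')). lra. }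
  destruct r as [|r]; [|apply Hpos; lia].
  apply kernel_integral_0_injective. intros x. rewrite <- (H0 x), kernel_sum_S.
  rewrite (lsumC_ext _ (fun _ => RtoC 0)), lsumC_0; [ring|].
  intros r' Hr'. apply in_seq in Hr'.
  replace (nu (S r')) with (fun _ : T => RtoC 0); [apply path_integral_0|].
  apply functional_extensionality; intros z. symmetry; apply Hpos; lia.
Qed.

Lemma polyharmonic_kernel_sum n f : polyharmonic p lam n f ->
  exists nu, (forall r, distribution (nu r)) /\ forall x, f x = kernel_sum n nu x.
Proof.
  revert f; induction n as [|n IH]; intros f Hf.
  - exists (fun _ _ => 0). split; [intros; apply distribution_0|]. apply Hf.
  - apply polyharmonic_S in Hf. destruct Hf as [Hs Hf].
    destruct (IH _ Hf) as [nu [Hnu HE]].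
    (* The inverse of [shift]: dividing by [- (r + 1)] gives a sum [g] with the same image under
       [lam - P] as [f], so that [f - g] is harmonic. *)
    set (nt := fun r v => - / RtoC (INR (S r)) * nu r v + 0).
    assert (Hnt : forall r, distribution (nt r)).
    { intros r. apply (distribution_lin _ _ (fun _ => 0)); [apply Hnu|apply distribution_0]. }
    set (g := kernel_sum (S n) (fun r => match r with O => (fun _ => 0) | S r => nt r end)).
    assert (Hd : forall r, (r < S n)%nat ->
      distribution (match r with O => (fun _ => 0) | S r => nt r end)).
    { intros [|r] _; [apply distribution_0|apply Hnt]. }
    assert (Hg := kernel_sum_p_summable _ _ Hd). fold g in Hg.
    destruct (harmonic_representation (fun x => f x + (-1) * g x)) as [nu0 [Hnu0 HE0]].
    + apply p_summable_plus; [exact Hs|apply p_summable_scal, Hg].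
    + intros x. rewrite Lap_lin by assumption. unfold g.
      rewrite (Lap_kernel_sum _ _ _ Hd), HE.
      replace (kernel_sum n (shift (fun r => match r with O => (fun _ => 0) | S r => nt r end)))
        with (kernel_sum n nu); [ring|].
      f_equal. apply functional_extensionality; intros r.
      apply functional_extensionality; intros v. unfold shift, nt. field.
      intros E. apply RtoC_inj in E. assert (Hn := lt_0_INR (S r) (Nat.lt_0_succ r)). lra.
    + exists (fun r => match r with O => nu0 | S r => nt r end). split.
      * intros [|r]; auto.
      * intros x. rewrite kernel_sum_S, <- HE0. unfold g. rewrite kernel_sum_S.
        rewrite (path_integral_0 _ x : kernel_integral 0 (fun _ => 0) x = 0). ring.
Qed.

End KernelIntegrals.
End BoundaryIntegrals.

(** * Integral representation of polyharmonic functions *)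

Theorem theorem5p3 (T : Type) (adj : T -> T -> Prop) (p : T -> T -> R) (o : T)
  (lam : C) (n : nat) :
  is_tree adj -> no_leaves adj -> countable T -> stochastic adj p ->
  in_res_star adj o p lam -> (1 <= n)%nat ->
  (forall f : T -> C, polyharmonic p lam n f ->
     exists nu : nat -> T -> C,
       (forall r, (r < n)%nat -> distribution adj o (nu r)) /\
       (forall x, f x = represent adj o p lam n nu x) /\
       (forall nu' : nat -> T -> C,
          (forall r, (r < n)%nat -> distribution adj o (nu' r)) ->
          (forall x, f x = represent adj o p lam n nu' x) ->
          forall r, (r < n)%nat -> forall x, nu' r x = nu r x))
  /\
  (forall (f : T -> C) (nu : nat -> T -> C),
     (forall r, (r < n)%nat -> distribution adj o (nu r)) ->
     (forall x, f x = represent adj o p lam n nu x) ->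
     polyharmonic p lam n f).
Proof.
  intros Htree Hnl _ Hst [Hres Hdiag] _.
  destruct (in_res_regular adj o p Htree Hst lam Hres) as [M Hreg].
  split.
  - intros f Hf.
    destruct (polyharmonic_kernel_sum adj o p Htree Hst lam M Hreg Hdiag n f Hf) as [nu [Hnu HE]].
    assert (Hnu' : forall r, (r < n)%nat -> distribution adj o (nu r)) by (intros; apply Hnu).
    exists nu. split; [exact Hnu'|]. split.
    + intros x. rewrite HE. symmetry. apply (represent_kernel_sum adj o p Htree Hst); assumption.
    + intros nu' Hd HE' r Hr x.
      assert (E : (-1 * nu r x + nu' r x = 0)%C).
      { apply (kernel_sum_injective adj o p Htree Hst lam M Hreg Hdiag n
          (fun r x => -1 * nu r x + nu' r x)%C); [| |exact Hr].
        - intros r' Hr'. apply distribution_lin; auto.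
        - intros z. transitivity (-1 * kernel_sum adj o p lam n nu z + kernel_sum adj o p lam n nu' z)%C.
          + unfold kernel_sum. rewrite <- lsumC_scal, <- lsumC_plus. apply lsumC_ext; intros.
            apply (path_integral_lin adj o Htree).
          + rewrite <- HE, <- (represent_kernel_sum adj o p Htree Hst lam Hnl n nu' z Hd), <- HE'. ring. }
      replace (nu' r x) with (nu r x + (-1 * nu r x + nu' r x))%C by ring. rewrite E; ring.
  - intros f nu Hnu HE.
    replace f with (kernel_sum adj o p lam n nu).
    + apply (kernel_sum_polyharmonic adj o p Htree Hst lam M Hreg Hdiag), Hnu.
    + apply functional_extensionality; intros x. rewrite HE. symmetry.
      apply (represent_kernel_sum adj o p Htree Hst); assumption.
Qed.
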